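(* For $\mathfrak p_1, \mathfrak p_2$ causal strategies on an arena $A$ such that $\mathrm{Pos}(\mathfrak p_1) = \mathrm{Pos}(\mathfrak p_2)$, we have $\mathfrak p_1 \cong \mathfrak p_2$.
   Context: An arena is $A=(|A|,\le_A,\lambda_A)$, a partial order with polarity $\lambda_A:|A|\to\{-,+\}$, finitary, forest-shaped, alternating (if $a_1\prec_A a_2$ then $\lambda_A(a_1)\neq\lambda_A(a_2)$) and with negative minimal moves; $A$ is assumed well-opened (exactly one minimal move). Here $a_1\prec_A a_2$ means $a_1<_A a_2$ with no event strictly between; the same notation $\prec$ is used for immediate causality in any order. A configuration $x$ of $A$ is a finite tree $(|x|,\le_x)$ with display map $\partial_x:|x|\to|A|$ such that $a$ is minimal iff $\partial_x(a)$ is minimal and $a_1\prec_x a_2\Rightarrow\partial_x(a_1)\prec_A\partial_x(a_2)$; an isomorphism of configurations is a bijection preserving $\partial$ with $a_1\prec_x a_2\iff\varphi(a_1)\prec_y\varphi(a_2)$. An augmentation $\mathfrak q$ on $A$ is a set of events $|\mathfrak q|$ with two orders $\le_{D(\mathfrak q)}$, $\le_{\mathfrak q}$ and a map $\partial_{\mathfrak q}:|\mathfrak q|\to|A|$ such that $D(\mathfrak q)=(|\mathfrak q|,\le_{D(\mathfrak q)},\partial_{\mathfrak q})$ is a configuration and $(|\mathfrak q|,\le_{\mathfrak q})$ is a tree, satisfying: rule-abiding ($a_1\le_{D(\mathfrak q)}a_2\Rightarrow a_1\le_{\mathfrak q}a_2$); courteous (if $a_1\prec_{\mathfrak q}a_2$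 and $\lambda(a_1)=+$ or $\lambda(a_2)=-$ then $a_1\prec_{D(\mathfrak q)}a_2$); deterministic ($a^-\prec_{\mathfrak q}a_1^+$, $a^-\prec_{\mathfrak q}a_2^+\Rightarrow a_1=a_2$), where $\lambda(a)=\lambda_A(\partial_{\mathfrak q}(a))$. It is receptive if whenever $\partial_{\mathfrak q}(a)\prec_A b^-$ there is $a\prec_{\mathfrak q}b'$ with $\partial_{\mathfrak q}(b')=b$, and $-$-linear if $a\prec_{\mathfrak q}a_1^-$, $a\prec_{\mathfrak q}a_2^-$, $\partial_{\mathfrak q}(a_1)=\partial_{\mathfrak q}(a_2)$ imply $a_1=a_2$. A causal strategy is a receptive $-$-linear augmentation. A morphism $\varphi:\mathfrak q\to\mathfrak p$ is a map on events with $\partial_{\mathfrak p}\circ\varphi=\partial_{\mathfrak q}$, preserving $\prec_{\mathfrak q}$ and $\prec_{D(\mathfrak q)}$; an isomorphism $\cong$ is an invertible morphism. For a causal strategy $\mathfrak p$, an expansion $\mathfrak q\in\mathrm{Exp}(\mathfrak p)$ is an augmentation with a morphism $\varphi:\mathfrak q\to\mathfrak p$ that is $+$-obsessional: for all $a^-\in|\mathfrak q|$ and $\varphi(a)\prec_{\mathfrak p}b^+$ there is $a\prec_{\mathfrak q}a'$ with $\varphi(a')=b$. $\mathrm{Pos}(\mathfrak p)$ is the set of isomorphism classes of $D(\mathfrak q)$ for $\mathfrak q\in\mathrm{Exp}(\mathfrak p)$. *)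

(* Defs.v *)
From mathcomp Require Import all_boot all_order.
From mathcomp Require Import classical_sets cardinality.

Set Implicit Arguments.
Unset Strict Implicit.
Unset Printing Implicit Defensive.

Local Open Scope classical_set_scope.

(* Orders are handled as relations, because an augmentation carries two        *)
(* different orders on the same set of events.                                 *)

Section Orders.
Context (T : eqType) (le : rel T).
Implicit Types a b c : T.

Definition partial_order : Prop :=
  [/\ reflexive le, antisymmetric le & transitive le].

Definition strict a b : bool := (a != b) && le a b.

Definition prec a b : Prop :=
  strict a b /\ ~ exists c, strict a c /\ strict c b.

Definition minimal a : Prop := ~ exists b, strict b a.

Definition forest_shaped : Prop :=
  forall a b c, le a c -> le b c -> le a b \/ le b a.

Definition is_tree : Prop :=
  [/\ partial_order, forest_shaped & exists! a, minimal a].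

End Orders.

Variant polarity := Neg | Pos.

Record arena := Arena {
  arena_display : Order.disp_t;
  move :> porderType arena_display;
  pol : move -> polarity;
  arena_finitary : forall a : move, finite_set [set b | (b <= a)%O];
  arena_forest : forest_shaped (<=%O : rel move);
  arena_alternating : forall a1 a2 : move, prec <=%O a1 a2 -> pol a1 <> pol a2;
  arena_negative : forall a : move, minimal <=%O a -> pol a = Neg;
  arena_well_opened : exists! a : move, minimal <=%O a
}.

Record configuration (A : arena) := Configuration {
  event :> finType;
  cle : rel event;
  display : event -> A;
  cle_tree : is_tree cle;
  display_minimal : forall a, minimal cle a <-> minimal <=%O (display a);
  display_prec : forall a1 a2,
    prec cle a1 a2 -> prec <=%O (display a1) (display a2)
}.

Definition config_iso (A : arena) (x y : configuration A) : Prop :=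
  exists phi : x -> y,
    [/\ bijective phi,
        forall a, display (phi a) = display a
      & forall a1 a2, prec (@cle A x) a1 a2 <-> prec (@cle A y) (phi a1) (phi a2)].

(* Classes of configurations are plain predicates: [set] is universe-monomorphic *)
(* and cannot be applied to a type of structures with a [finType] carrier.       *)
Definition iso_class (A : arena) (x : configuration A) :
    configuration A -> Prop :=
  fun y => config_iso x y.

(* [desq q] is D(q); the events and the display map of q are those of D(q).    *)
Record augmentation (A : arena) := Augmentation {
  desq :> configuration A;
  ale : rel desq;
  ale_tree : is_tree ale;
  rule_abiding : forall a1 a2, cle a1 a2 -> ale a1 a2;
  courteous : forall a1 a2, prec ale a1 a2 ->
    pol (display a1) = Pos \/ pol (display a2) = Neg ->
    prec (@cle A desq) a1 a2;
  deterministic : forall a a1 a2,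
    pol (display a) = Neg ->
    pol (display a1) = Pos -> pol (display a2) = Pos ->
    prec ale a a1 -> prec ale a a2 -> a1 = a2
}.

Section Augmentations.
Context (A : arena).
Implicit Types p q : augmentation A.

Definition dprec q (a b : q) : Prop := prec (@cle A q) a b.

Definition aprec q (a b : q) : Prop := prec (@ale A q) a b.

Definition epol q (a : q) : polarity := pol (display a).

Definition receptive q : Prop :=
  forall (a : q) (b : A), pol b = Neg -> prec <=%O (display a) b ->
    exists b' : q, aprec a b' /\ display b' = b.

Definition minus_linear q : Prop :=
  forall a a1 a2 : q, epol a1 = Neg -> epol a2 = Neg ->
    aprec a a1 -> aprec a a2 -> display a1 = display a2 -> a1 = a2.

Definition causal_strategy p : Prop := receptive p /\ minus_linear p.

Definition morphism q p (phi : q -> p) : Prop :=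
  [/\ forall a, display (phi a) = display a,
      forall a1 a2, aprec a1 a2 -> aprec (phi a1) (phi a2)
    & forall a1 a2, dprec a1 a2 -> dprec (phi a1) (phi a2)].

Definition isomorphic q p : Prop :=
  exists (phi : q -> p) (psi : p -> q),
    [/\ morphism phi, morphism psi, cancel phi psi & cancel psi phi].

Definition plus_obsessional q p (phi : q -> p) : Prop :=
  forall (a : q) (b : p), epol a = Neg -> epol b = Pos -> aprec (phi a) b ->
    exists a' : q, aprec a a' /\ phi a' = b.

Definition expansion p q : Prop :=
  exists phi : q -> p, morphism phi /\ plus_obsessional phi.

Definition positions p : (configuration A -> Prop) -> Prop :=
  fun X => exists q, expansion p q /\ X = iso_class (desq q).

End Augmentations.

(* Main.v *)
From mathcomp Require Import all_boot all_order.
From mathcomp Require Import boolp.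
Require Import Defs.

(** In a causal strategy every Opponent event has at most one Player answer, so a
strategy is determined by the function sending an Opponent event to the label,
the justifier and the continuations of its answer. An expansion duplicates
Opponent events: the copies sharing a justifier and a label form a fork, and
the events of a fork all behave in the same way. Forks are visible in the
desequentialization, whereas the link from an Opponent event to its answer is
not.

Take the expansion [q] of [p1] in which distinct forks have cardinalities that
are distinct powers of two, all at least 2 (except for the root). If
[D(q)] is also [D(q')] for some expansion [q'] of [p2], both expansions order the
same events, and we show by induction on [n] that every
Opponent event has the same behaviour up to [n] answers in both. For a fixed
behaviour [t] (in which justifiers outside of the continuation are named by
the events themselves), the Player events with behaviour [t] are the same in
[q] and [q'] by induction. The Opponent events they answer form a union of
forks, plus at most one event that [t] itself mentions. Their number is the
same in both expansions, so by uniqueness of binary expansions the forks are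
the same and the exceptional event exists in both or in neither; it is the same
event in both because its fork has at least two elements. At the root
this says that [p1] and [p2] have the same unfolding. *)

Set Implicit Arguments.
Unset Strict Implicit.
Unset Printing Implicit Defensive.

(** * Finite forests *)

Section FiniteForest.
Context (T : finType) (le : rel T).
Hypothesis lePO : partial_order le.
Implicit Types a b c : T.

Let lexx : reflexive le. Proof. by case: lePO. Qed.
Let le_anti : antisymmetric le. Proof. by case: lePO. Qed.
Let le_trans : transitive le. Proof. by case: lePO. Qed.

Lemma strictW a b : strict le a b -> le a b.
Proof. by case/andP. Qed.

Lemma strict_le_trans b a c : strict le a b -> le b c -> strict le a c.
Proof.
case/andP=> ab leab lebc; rewrite /strict (le_trans leab lebc) andbT.
by apply: contra ab => /eqP ac; rewrite -ac in lebc; apply/eqP/le_anti/andP.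
Qed.

Lemma le_strict_trans b a c : le a b -> strict le b c -> strict le a c.
Proof.
move=> leab /andP[bc lebc]; rewrite /strict (le_trans leab lebc) andbT.
by apply: contra bc => /eqP ac; rewrite ac in leab; apply/eqP/le_anti/andP.
Qed.

Lemma strict_irr a : ~ strict le a a.
Proof. by rewrite /strict eqxx. Qed.

Lemma le_eqVstrict a b : le a b -> a = b \/ strict le a b.
Proof. by move=> leab; rewrite /strict leab; case: eqP => [|_]; [left|right]. Qed.

Lemma card_down_strict a b :
  strict le a b -> #|[set x | le x a]| < #|[set x | le x b]|.
Proof.
move=> ab; apply: proper_card; apply/properP; split.
  by apply/subsetP=> x; rewrite !inE => xa; exact: le_trans xa (strictW ab).
exists b; rewrite inE ?lexx //; apply/negP=> ba.
exact: (strict_irr (strict_le_trans ab ba)).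
Qed.

Lemma strict_ind (P : T -> Prop) :
  (forall x, (forall y, strict le y x -> P y) -> P x) -> forall x, P x.
Proof.
move=> IH x; have [n] := ubnP #|[set y | le y x]|.
elim: n x => // n IHn x /ltnSE-hx; apply: IH => y yx; apply: IHn.
exact: leq_trans (card_down_strict yx) hx.
Qed.

(** By finiteness: an element above [a] and strictly below [b] whose down-set is largest must be an
    immediate predecessor of [b]. *)
Lemma strict_prec a b : strict le a b -> exists c, le a c /\ prec le c b.
Proof.
move=> ab; pose P c := le a c && strict le c b.
have Pa : P a by rewrite /P lexx.
case: (arg_maxnP (fun c => #|[set x | le x c]|) Pa) => c /andP[ac cb] cmax.
exists c; split=> //; split=> // -[d [cd db]].
have Pd : P d by rewrite /P db (le_trans ac (strictW cd)).
by have := leq_trans (card_down_strict cd) (cmax d Pd); rewrite ltnn.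
Qed.

Lemma minimal_or_prec b : minimal le b \/ exists a, prec le a b.
Proof.
case: (pselect (exists a, prec le a b)) => [|nb]; [by right|left].
by move=> [a /strict_prec[c [_ cb]]]; apply: nb; exists c.
Qed.

Lemma prec_not_minimal a b : prec le a b -> ~ minimal le b.
Proof. by move=> [ab _]; apply; exists a. Qed.

Hypothesis leF : forest_shaped le.

Lemma prec_le a b c : prec le c b -> strict le a b -> le a c.
Proof.
move=> [cb ncb] ab; case: (leF (strictW cb) (strictW ab)) => // ca.
case: (le_eqVstrict ca) => [->|ca']; first exact: lexx.
by case: ncb; exists a.
Qed.

Lemma prec_inj a b c : prec le a c -> prec le b c -> a = b.
Proof.
move=> ac bc; apply: le_anti.
by rewrite (prec_le bc) ?(prec_le ac) //; [case: bc|case: ac].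
Qed.

Lemma prec_siblings a b c : prec le a b -> prec le a c -> le b c -> b = c.
Proof.
move=> ab ac /le_eqVstrict[//|bc]; case: ac => _ []; exists b.
by split=> //; case: ab.
Qed.

End FiniteForest.

Lemma least_root (T : finType) (le : rel T) r x :
  is_tree le -> minimal le r -> le r x.
Proof.
case=> lePO _ [r' [_ ur]] mr; have lexx : reflexive le by case: lePO.
have le_tr : transitive le by case: lePO.
elim/(strict_ind lePO): x => x IH.
case: (minimal_or_prec lePO x) => [mx|[y [yx _]]].
  by rewrite -(ur r mr) (ur x mx).
exact: le_tr (IH y yx) (strictW yx).
Qed.

Lemma minimal_inj (T : finType) (le : rel T) r x :
  is_tree le -> minimal le r -> minimal le x -> r = x.
Proof. by case=> _ _ [r' [_ ur]] mr mx; rewrite -(ur r mr) (ur x mx). Qed.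

Lemma prec_strict_morph (T U : finType) (le : rel T) (le' : rel U) (f : T -> U) :
  partial_order le -> partial_order le' ->
  (forall a b, prec le a b -> prec le' (f a) (f b)) ->
  forall a b, strict le a b -> strict le' (f a) (f b).
Proof.
move=> lePO le'PO fP a; elim/(strict_ind lePO) => b IH ab.
have [c [ac cb]] := strict_prec lePO ab; have [fcb _] := fP _ _ cb.
case: (le_eqVstrict ac) => [->//|ac'].
by have := IH c (proj1 cb) ac' => /strictW/(le_strict_trans le'PO); exact.
Qed.

(** * Justifiers and children in a configuration *)

Section Configurations.
Context (A : arena) (C : configuration A).
Implicit Types a b c x y : C.

Definition neg x : bool := if pol (display x) is Neg then true else false.

Lemma is_negP x : reflect (pol (display x) = Neg) (neg x).
Proof. by rewrite /neg; case: (pol _); constructor. Qed.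

Lemma is_posP x : reflect (pol (display x) = Pos) (~~ neg x).
Proof. by rewrite /neg; case: (pol _); constructor. Qed.

Lemma clePO : partial_order (@cle A C).
Proof. by case: (cle_tree C). Qed.

Lemma cleF : forest_shaped (@cle A C).
Proof. by case: (cle_tree C). Qed.

Lemma dprec_neg a b : prec (@cle A C) a b -> neg b = ~~ neg a.
Proof.
move=> /display_prec/arena_alternating; rewrite /neg.
by case: (pol (display a)); case: (pol (display b)).
Qed.

Lemma root_neg a : minimal (@cle A C) a -> neg a.
Proof. by move=> /display_minimal/arena_negative/is_negP. Qed.

(* Junk value: the root is its own justifier. *)
Definition just b : C := odflt b [pick a | `[<prec (@cle A C) a b>]].

Lemma just_eq a b : prec (@cle A C) a b -> just b = a.
Proof.
move=> ab; rewrite /just; case: pickP => [a' /asboolP a'b|/(_ a)/asboolP//].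
exact: prec_inj clePO cleF _ _ _ a'b ab.
Qed.

Lemma just_prec b : ~~ neg b -> prec (@cle A C) (just b) b.
Proof.
move=> pb; case: (minimal_or_prec clePO b) => [/root_neg nb|[a ab]].
  by rewrite nb in pb.
by rewrite (just_eq ab).
Qed.

(* In an expansion this selects one of the copies of the child. *)
Definition child b (m : A) : option C :=
  [pick x | `[<prec (@cle A C) b x>] && (display x == m)].

Lemma child_some b m x : child b m = Some x -> prec (@cle A C) b x /\ display x = m.
Proof. by rewrite /child; case: pickP => // y /andP[/asboolP ? /eqP ?] [<-]. Qed.

Lemma child_none b m x : child b m = None -> prec (@cle A C) b x -> display x <> m.
Proof.
rewrite /child; case: pickP => // h _ bx /eqP dx.
by have /negP[] := negbT (h x); rewrite dx andbT; apply/asboolP.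
Qed.

(* Receptivity of an augmentation, stated on its desequentialization alone, so
   that it is shared by the expansions with the same configuration. *)
Definition full : Prop := forall b (m : A), pol m = Neg ->
  prec <=%O (display b) m -> exists x, prec (@cle A C) b x /\ display x = m.

End Configurations.

(** * Causal orders on a fixed configuration *)

Section Sequentializations.
Context (A : arena) (C : configuration A).

(** The axioms of [ale] in an augmentation, for an arbitrary relation on the events of [C], so that
    two causal orders on the same events can be compared. *)
Record sequentialization (le : rel C) : Prop := Sequentialization {
  seq_tree : is_tree le;
  seq_rule : forall a b, cle a b -> le a b;
  seq_court : forall a b, prec le a b ->
    pol (display a) = Pos \/ pol (display b) = Neg -> prec (@cle A C) a b;
  seq_det : forall a b c, pol (display a) = Neg ->
    pol (display b) = Pos -> pol (display c) = Pos ->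
    prec le a b -> prec le a c -> b = c
}.

Context (le : rel C).
Hypothesis leS : sequentialization le.
Implicit Types a b c : C.

Lemma seqPO : partial_order le. Proof. by case: leS => -[]. Qed.
Lemma seqF : forest_shaped le. Proof. by case: leS => -[]. Qed.

Lemma seq_strict a b : strict (@cle A C) a b -> strict le a b.
Proof. by case/andP=> ab leab; rewrite /strict ab (seq_rule leS). Qed.

Lemma seq_minimal a : minimal le a <-> minimal (@cle A C) a.
Proof.
have h x : minimal le x -> minimal (@cle A C) x.
  by move=> mx [y yx]; apply: mx; exists y; exact: seq_strict.
split; first exact: h.
move=> ma; have [_ _ [r [mr _]]] := seq_tree leS.
by rewrite (minimal_inj (cle_tree C) ma (h _ mr)).
Qed.

Lemma seq_prec_neg a b : prec le a b -> neg b = ~~ neg a.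
Proof.
move=> ab; case: (boolP (neg a)) => na; case: (boolP (neg b)) => nb //=.
  by rewrite -nb (dprec_neg (seq_court leS ab _)) ?na //; right; apply/is_negP.
have := dprec_neg (seq_court leS ab (or_introl (is_posP _ na))).
by rewrite (negbTE nb) na.
Qed.

Lemma seq_prec_dprec a b : neg b -> prec le a b -> prec (@cle A C) a b.
Proof. by move=> /is_negP nb ab; apply: (seq_court leS ab); right. Qed.

(** Courtesy makes the causal predecessor of an Opponent event its justifier, and justifiers are
    unique; so at Opponent events all sequentializations agree. *)
Lemma dprec_seq_prec a b : neg b -> prec (@cle A C) a b -> prec le a b.
Proof.
move=> nb ab; case: (minimal_or_prec seqPO b) => [/seq_minimal|[c cb]].
  by have := prec_not_minimal ab.
by rewrite (prec_inj (clePO C) (@cleF _ C) ab (seq_prec_dprec nb cb)).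
Qed.

Lemma pos_seq_prec b : ~~ neg b -> exists2 a, neg a & prec le a b.
Proof.
move=> pb; case: (minimal_or_prec seqPO b) => [/seq_minimal/root_neg nb|[a ab]].
  by rewrite nb in pb.
by exists a => //; rewrite (seq_prec_neg ab) negbK in pb.
Qed.

Definition ans a : option C := [pick b | `[<prec le a b>]].

Lemma ans_some a b : ans a = Some b -> prec le a b.
Proof. by rewrite /ans; case: pickP => // c /asboolP ? [<-]. Qed.

Lemma ans_none a b : ans a = None -> ~ prec le a b.
Proof. by rewrite /ans; case: pickP => // h _ /asboolP; rewrite h. Qed.

Lemma ans_prec a b : neg a -> prec le a b -> ans a = Some b.
Proof.
move=> na ab; case E: (ans a) => [c|]; last by case: (ans_none E ab).
have ac := ans_some E; congr Some.
apply: (seq_det leS _ _ _ ac ab); first exact/is_negP.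
  by apply/is_posP; rewrite (seq_prec_neg ac) na.
by apply/is_posP; rewrite (seq_prec_neg ab) na.
Qed.

Lemma just_strict b : ~~ neg b -> strict le (just b) b.
Proof. by case/just_prec => /seq_strict. Qed.

Lemma just_neg b : ~~ neg b -> neg (just b).
Proof. by move=> pb; have := dprec_neg (just_prec pb); rewrite (negbTE pb); case: neg. Qed.

Lemma just_ans a b : neg a -> prec le a b -> le (just b) a.
Proof.
move=> na ab; apply: (prec_le seqPO seqF ab); apply: just_strict.
by rewrite (seq_prec_neg ab) na.
Qed.

End Sequentializations.

(** * Behaviours *)

(* Behaviours: a justifier is [inl k] for the Opponent event bound at level [k]
   (counted from the outside), or [inr e] for an event [e] outside of the term. *)
Inductive term (N L : Type) : Type := Silent | Answer (p : N) (m : L) (f : L -> term N L).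
Arguments Silent {N L}.

Fixpoint tmap (N N' L : Type) (g : N -> N') (t : term N L) : term N' L :=
  if t is Answer p m f then Answer (g p) m (fun c => tmap g (f c)) else Silent.

Fixpoint occ (N L : Type) (z : N) (t : term N L) : Prop :=
  if t is Answer p m f then p = z \/ exists c, occ z (f c) else False.

Lemma tmap_id_occ (N L : Type) (g : N -> N) (t : term N L) :
  (forall z, occ z t -> g z = z) -> tmap g t = t.
Proof.
elim: t => //= p m f IH h; rewrite h; last by left.
by congr Answer; apply: funext => c; apply: IH => z zc; apply: h; right; exists c.
Qed.

Lemma tmap_comp (N N' N'' L : Type) (g : N -> N') (h : N' -> N'') (t : term N L) :
  tmap h (tmap g t) = tmap (h \o g) t.
Proof. by elim: t => //= p m f IH; congr Answer; apply: funext. Qed.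

Lemma occ_tmap (N N' L : Type) (g : N -> N') z (t : term N L) :
  occ z t -> occ (g z) (tmap g t).
Proof.
elim: t => //= p m f IH [->|[c zc]]; first by left.
by right; exists c; apply: IH.
Qed.

Section Unfolding.
Context (A : arena) (C : configuration A) (le : rel C) (E : Type).
Implicit Types (a b e x : C) (rho : C -> nat + E).

Definition set_env rho a k : C -> nat + E :=
  fun e => if e == a then inl k else rho e.

(** [n] bounds the number of nested answers, [k] is the next level to bind and [rho] is the current
    naming of events. The body of [ptree] is inlined to keep the recursion structural in [n];
    [otreeS] folds it back. *)
Fixpoint otree n k rho a : term (nat + E) A :=
  if n is n'.+1 then
    oapp (fun b => Answer (set_env rho a k (just b)) (display b) (fun m =>
            oapp (otree n' k.+1 (set_env rho a k)) Silent (child b m)))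
         Silent (ans le a)
  else Silent.

Definition ptree n k rho b : term (nat + E) A :=
  Answer (rho (just b)) (display b) (fun m => oapp (otree n k rho) Silent (child b m)).

Lemma otreeS n k rho a :
  otree n.+1 k rho a = oapp (ptree n k.+1 (set_env rho a k)) Silent (ans le a).
Proof. by []. Qed.

Hypothesis leS : sequentialization le.

Lemma strict_neg_pred a b e :
  prec le a b -> strict le e b -> neg e != neg a -> strict le e a.
Proof.
move=> ab eb; apply: contraNT => nea.
have /(le_eqVstrict)[-> //|ea] := prec_le (seqPO leS) (@seqF _ _ _ leS) ab eb.
by rewrite ea in nea.
Qed.

Lemma le_pred a b e : prec le a b -> strict le e b -> le e a.
Proof. by move=> ab eb; apply: (prec_le (seqPO leS) (@seqF _ _ _ leS) ab eb). Qed.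

(** Bounds the names in a behaviour: a justifier lies causally below its event, so it is either an
    Opponent event strictly below [a] or one bound on the way, at level [k] or later. *)
Definition occ_in k rho a z :=
  (exists e, [/\ neg e, strict le e a & z = rho e]) \/ exists i, z = inl (k + i).

Lemma occ_in_child k rho b x z :
  ~~ neg b -> prec le b x -> occ_in k rho x z -> occ_in k rho b z.
Proof.
move=> pb bx [[e [ne ex ->]]|?]; [left|by right].
by exists e; split=> //; apply: (strict_neg_pred bx ex); rewrite ne (negbTE pb).
Qed.

Lemma occ_in_ans k rho a b z : neg a ->
  prec le a b -> occ_in k.+1 (set_env rho a k) b z -> occ_in k rho a z.
Proof.
move=> na ab [[e [ne eb ->]]|[i ->]]; last first.
  by right; exists i.+1; rewrite addnS addSn.
case: (le_eqVstrict (le_pred ab eb)) => [->|ea].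
  by rewrite /set_env eqxx; right; exists 0; rewrite addn0.
by left; exists e; split=> //; rewrite /set_env; case/andP: ea => /negbTE ->.
Qed.

Lemma child_seq b m x : ~~ neg b -> child b m = Some x -> neg x /\ prec le b x.
Proof.
move=> pb /child_some[bx _]; have nx : neg x by rewrite (dprec_neg bx).
by split=> //; apply: (dprec_seq_prec leS).
Qed.

Lemma occ_ptree_aux n :
  (forall k rho a z, neg a -> occ z (otree n k rho a) -> occ_in k rho a z) ->
  forall k rho b z, ~~ neg b -> occ z (ptree n k rho b) -> occ_in k rho b z.
Proof.
move=> IH k rho b z pb /= [<-|[m]].
  by left; exists (just b); split=> //; [exact: just_neg|exact: just_strict].
case E1: (child b m) => [x|] //= zx; have [nx bx] := child_seq pb E1.
exact: occ_in_child pb bx (IH _ _ _ _ nx zx).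
Qed.

Lemma occ_otree n k rho a z : neg a -> occ z (otree n k rho a) -> occ_in k rho a z.
Proof.
elim: n k rho a z => [//|n IH] k rho a z na; rewrite otreeS.
case E1: (ans le a) => [b|] //; have ab := ans_some E1.
move=> /= zb; apply: (occ_in_ans na ab).
have pb : ~~ neg b by rewrite (seq_prec_neg leS ab) na.
exact: (@occ_ptree_aux n IH _ _ _ _ pb zb).
Qed.

Lemma occ_ptree n k rho b z : ~~ neg b -> occ z (ptree n k rho b) -> occ_in k rho b z.
Proof. by apply: (@occ_ptree_aux n) => k' rho' a z'; exact: occ_otree. Qed.

End Unfolding.

(** * Bisimilar events have equal behaviours, up to renaming *)

Section Bisimulation.
Context (A : arena) (C1 C2 : configuration A) (le1 : rel C1) (le2 : rel C2).
Context (S : C1 -> C2 -> Prop).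

(** The existence of matching children comes from [full], so [bisim_child] only compares children
    with equal labels. The injectivity clauses give an event at most one partner on a branch, which
    keeps the bound levels in step. *)
Record bisim : Prop := Bisim {
  bisim_display : forall x y, S x y -> display x = display y;
  bisim_ans1 : forall a1 a2 b1, neg a1 -> S a1 a2 -> prec le1 a1 b1 ->
    exists2 b2, prec le2 a2 b2 & S b1 b2;
  bisim_ans2 : forall a1 a2 b2, neg a1 -> S a1 a2 -> prec le2 a2 b2 ->
    exists2 b1, prec le1 a1 b1 & S b1 b2;
  bisim_just : forall b1 b2, ~~ neg b1 -> S b1 b2 -> S (just b1) (just b2);
  bisim_child : forall b1 b2 x1 x2, ~~ neg b1 -> S b1 b2 ->
    prec le1 b1 x1 -> prec le2 b2 x2 -> display x1 = display x2 -> S x1 x2;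
  bisim_inj1 : forall x1 y1 x2, S x1 x2 -> S y1 x2 -> le1 x1 y1 -> x1 = y1;
  bisim_inj2 : forall x1 x2 y2, S x1 x2 -> S x1 y2 -> le2 x2 y2 -> x2 = y2
}.

Context (E1 E2 : Type) (g : nat + E1 -> nat + E2).
Hypotheses (leS1 : sequentialization le1) (leS2 : sequentialization le2).
Hypotheses (full1 : full C1) (full2 : full C2) (Sb : bisim).

Lemma bisim_neg x y : S x y -> neg x = neg y.
Proof. by move=> /(bisim_display Sb); rewrite /neg => ->. Qed.

Definition env_agree (rho1 : C1 -> nat + E1) (rho2 : C2 -> nat + E2) a1 a2 :=
  forall e1 e2, neg e1 -> strict le1 e1 a1 -> strict le2 e2 a2 -> S e1 e2 ->
    g (rho1 e1) = rho2 e2.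

Lemma ptree_bisim_aux n k k' :
  (forall rho1 rho2 a1 a2,
    neg a1 -> S a1 a2 -> env_agree rho1 rho2 a1 a2 ->
    tmap g (otree le1 n k rho1 a1) = otree le2 n k' rho2 a2) ->
  forall rho1 rho2 b1 b2,
    ~~ neg b1 -> S b1 b2 -> env_agree rho1 rho2 b1 b2 ->
    tmap g (ptree le1 n k rho1 b1) = ptree le2 n k' rho2 b2.
Proof.
move=> IH rho1 rho2 b1 b2 p1 Sbb agr; have p2 : ~~ neg b2 by rewrite -(bisim_neg Sbb).
have db := bisim_display Sb Sbb.
rewrite /ptree /= (agr (just b1) (just b2)) ?just_neg ?just_strict //; last first.
  exact: (bisim_just Sb).
rewrite db; congr Answer; apply: funext => m.
case Ex1: (child b1 m) => [x1|]; case Ex2: (child b2 m) => [x2|] //=.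
- have [nx1 bx1] := child_seq leS1 p1 Ex1; have [nx2 bx2] := child_seq leS2 p2 Ex2.
  have [_ d1] := child_some Ex1; have [_ d2] := child_some Ex2.
  apply: IH => //; first by apply: (bisim_child Sb p1 Sbb bx1 bx2); rewrite d1.
  move=> e1 e2 ne1 s1 s2 See; apply: agr => //.
    by apply: (strict_neg_pred leS1 bx1 s1); rewrite ne1 (negbTE p1).
  by apply: (strict_neg_pred leS2 bx2 s2); rewrite -(bisim_neg See) ne1 (negbTE p2).
(* A child with label [m] on one side only contradicts [full] on the other. *)
- have [bx1 d1] := child_some Ex1; have [nx1 _] := child_seq leS1 p1 Ex1.
  have [||x2 [bx2 d2]] := full2 (b := b2) (m := m).
  + by rewrite -d1; apply/is_negP.
  + by rewrite -db -d1; apply: display_prec.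
  by case: (child_none Ex2 bx2).
- have [bx2 d2] := child_some Ex2; have [nx2 _] := child_seq leS2 p2 Ex2.
  have [||x1 [bx1 d1]] := full1 (b := b1) (m := m).
  + by rewrite -d2; apply/is_negP.
  + by rewrite db -d2; apply: display_prec.
  by case: (child_none Ex1 bx1).
Qed.

(** The renaming [g] covers both a shift of levels and the passage from free events to bound
    levels. *)
Lemma otree_bisim n k k' rho1 rho2 a1 a2 :
  (forall i, g (inl (k + i)) = inl (k' + i)) ->
  neg a1 -> S a1 a2 -> env_agree rho1 rho2 a1 a2 ->
  tmap g (otree le1 n k rho1 a1) = otree le2 n k' rho2 a2.
Proof.
elim: n k k' rho1 rho2 a1 a2 => [//|n IH] k k' rho1 rho2 a1 a2 gk n1 Saa agr.
have n2 : neg a2 by rewrite -(bisim_neg Saa).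
rewrite !otreeS; case Eb1: (ans le1 a1) => [b1|] /=; last first.
  case Eb2: (ans le2 a2) => [b2|] //=.
  have [b1 ab1 _] := bisim_ans2 Sb n1 Saa (ans_some Eb2).
  by case: (ans_none Eb1 ab1).
have ab1 := ans_some Eb1; have [b2 ab2 Sbb] := bisim_ans1 Sb n1 Saa ab1.
rewrite (ans_prec leS2 n2 ab2) /=.
have p1 : ~~ neg b1 by rewrite (seq_prec_neg leS1 ab1) n1.
apply: (@ptree_bisim_aux n k.+1 k'.+1) => //.
  move=> rho rho' x1 x2; apply: IH => // i; have := gk i.+1; by rewrite !addnS !addSn.
move=> e1 e2 ne1 s1 s2 See; rewrite /set_env.
(* By injectivity on branches, [e1] is the newly bound event exactly when [e2] is; otherwise the old
   environments apply. *)
case: (le_eqVstrict (le_pred leS1 ab1 s1)) => [e1a|e1a].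
  have -> : e2 = a2 by rewrite e1a in See; apply: (bisim_inj2 Sb See Saa (le_pred leS2 ab2 s2)).
  by rewrite e1a !eqxx; have := gk 0; rewrite !addn0.
case: (le_eqVstrict (le_pred leS2 ab2 s2)) => [e2a|e2a].
  rewrite e2a in See; have e1E := bisim_inj1 Sb See Saa (le_pred leS1 ab1 s1).
  by rewrite e1E in e1a; case: (strict_irr e1a).
by have [/andP[/negbTE-> _] /andP[/negbTE-> _]] := (e1a, e2a); apply: agr.
Qed.

Lemma ptree_bisim n k k' rho1 rho2 b1 b2 :
  (forall i, g (inl (k + i)) = inl (k' + i)) ->
  ~~ neg b1 -> S b1 b2 -> env_agree rho1 rho2 b1 b2 ->
  tmap g (ptree le1 n k rho1 b1) = ptree le2 n k' rho2 b2.
Proof. by move=> gk; apply: ptree_bisim_aux => rho rho' a1 a2; exact: otree_bisim. Qed.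

End Bisimulation.

Lemma aug_seq (A : arena) (p : augmentation A) : sequentialization (@ale A p).
Proof.
by split; [exact: ale_tree|exact: rule_abiding|exact: courteous|exact: deterministic].
Qed.

(** * Expansions as views of a configuration *)

(** An expansion of [p] with desequentialization [C], as a causal order and a map. In [view_obs],
    alternation makes [b] a Player event. *)
Record view (A : arena) (C : configuration A) (le : rel C) (p : augmentation A)
    (phi : C -> p) : Prop := View {
  view_seq : sequentialization le;
  view_display : forall a, display (phi a) = display a;
  view_prec : forall a b, prec le a b -> prec (@ale A p) (phi a) (phi b);
  view_dprec : forall a b, prec (@cle A C) a b -> prec (@cle A p) (phi a) (phi b);
  view_obs : forall a b, neg a -> prec (@ale A p) (phi a) b ->
    exists2 a', prec le a a' & phi a' = b
}.

Lemma view_id (A : arena) (p : augmentation A) : view (@ale A p) (@id p).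
Proof. by split=> // [|a b _ ab]; [exact: aug_seq|exists b]. Qed.

Lemma view_neg (A : arena) (C : configuration A) (le : rel C) (p : augmentation A)
  (phi : C -> p) : view le phi -> forall x, neg (phi x) = neg x.
Proof. by move=> V x; rewrite /neg (view_display V). Qed.

Lemma view_strict (A : arena) (C : configuration A) (le : rel C) (p : augmentation A)
  (phi : C -> p) : view le phi ->
  forall a b, strict le a b -> strict (@ale A p) (phi a) (phi b).
Proof.
move=> V; apply: prec_strict_morph (view_prec V); apply: seqPO.
  exact: view_seq V.
exact: aug_seq.
Qed.

Lemma view_inj (A : arena) (C : configuration A) (le : rel C) (p : augmentation A)
  (phi : C -> p) : view le phi ->
  forall a b, le a b -> phi a = phi b -> a = b.
Proof.
move=> V a b /le_eqVstrict[//|/(view_strict V)] + eab.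
by rewrite eab => /strict_irr.
Qed.

(** Answers are lifted by obsessionality, children with equal labels have equal images by
    $-$-linearity, and a view is injective on branches. *)
Lemma view_bisim (A : arena) (p : augmentation A) (C1 C2 : configuration A)
  (le1 : rel C1) (le2 : rel C2) (phi1 : C1 -> p) (phi2 : C2 -> p) :
  minus_linear p -> view le1 phi1 -> view le2 phi2 ->
  bisim le1 le2 (fun x y => phi1 x = phi2 y).
Proof.
move=> ml V1 V2; split.
- by move=> x y; rewrite -(view_display V1) -(view_display V2) => ->.
- move=> a1 a2 b1 n1 E ab; have := view_prec V1 ab; rewrite E => /(view_obs V2)[].
    by rewrite -(view_neg V2) -E (view_neg V1).
  by move=> b2 ? ?; exists b2.
- move=> a1 a2 b2 n1 E ab; have := view_prec V2 ab; rewrite -E => /(view_obs V1)[] //.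
  by move=> b1 ? ?; exists b1.
- move=> b1 b2 p1 E; have p2 : ~~ neg b2 by rewrite -(view_neg V2) -E (view_neg V1).
  have j1 := view_dprec V1 (just_prec p1); have j2 := view_dprec V2 (just_prec p2).
  by rewrite -E in j2; apply: prec_inj (clePO p) (@cleF _ p) _ _ _ j1 j2.
- move=> b1 b2 x1 x2 p1 E bx1 bx2 dx.
  have n1 : neg x1 by rewrite (seq_prec_neg (view_seq V1) bx1) p1.
  have n2 : neg x2 by move: n1; rewrite /neg dx.
  apply: (ml (phi1 b1)).
  + by apply/is_negP; rewrite (view_neg V1).
  + by apply/is_negP; rewrite (view_neg V2).
  + exact: (view_prec V1).
  + by rewrite /aprec E; exact: (view_prec V2).
  + by rewrite (view_display V1) (view_display V2).
- by move=> x1 y1 x2 <- E xy; apply: (view_inj V1 xy).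
- by move=> x1 x2 y2 -> E xy; apply: (view_inj V2 xy).
Qed.

Section OneView.
Context (A : arena) (C : configuration A) (le : rel C) (p : augmentation A).
Context (phi : C -> p).
Hypotheses (V : view le phi) (ml : minus_linear p) (fC : full C).
Implicit Types a b e x y : C.

Definition obeh n a := otree le n 0 (@inr nat C) a.
(* Level 0 is left free for [close_event]. *)
Definition pbeh n b := ptree le n 1 (@inr nat C) b.

(** Stated on the configuration alone, hence common to all sequentializations of [C]. *)
Definition fork x y : Prop := [/\ neg x, display x = display y &
  exists b, prec (@cle A C) b x /\ prec (@cle A C) b y].

Let leS := view_seq V.

Lemma chain_inj e1 e2 b : strict le e1 b -> strict le e2 b -> phi e1 = phi e2 -> e1 = e2.
Proof.
move=> e1b e2b E; case: (seqF leS (strictW e1b) (strictW e2b)) => h.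
  exact: (view_inj V h E).
exact/esym/(view_inj V h (esym E)).
Qed.

Lemma fork_neg x y : fork x y -> neg y.
Proof. by case=> + d _; rewrite /neg d. Qed.

Lemma fork_sym x y : fork x y -> fork y x.
Proof. by move=> f; have ny := fork_neg f; case: f => _ d [b [? ?]]; split=> //; exists b. Qed.

Lemma fork_le x y : fork x y -> le x y -> x = y.
Proof.
move=> f; have ny := fork_neg f; case: f => nx _ [b [bx bY]].
exact: prec_siblings (dprec_seq_prec leS nx bx) (dprec_seq_prec leS ny bY).
Qed.

(** The two events have the same image by $-$-linearity, hence are bisimilar; their free names agree
    because the Opponent events strictly below them are those below the common justifier. *)
Lemma fork_obeh n x y : fork x y -> obeh n x = obeh n y.
Proof.
move=> f; have ny := fork_neg f; case: f => nx dxy [b [bx bY]].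
have lbx := dprec_seq_prec leS nx bx; have lby := dprec_seq_prec leS ny bY.
rewrite -[LHS](@tmap_id_occ _ _ id) //.
have pb : ~~ neg b by have := dprec_neg bx; rewrite nx => <-.
have B := view_bisim ml V V.
apply: (otree_bisim leS leS fC fC B) => //.
  exact: (bisim_child B pb (erefl _) lbx lby dxy).
move=> e1 e2 ne1 s1 s2 E; congr inr.
have bb1 := strict_neg_pred leS lbx s1; have bb2 := strict_neg_pred leS lby s2.
have ne2 : neg e2 by rewrite -(view_neg V) -E (view_neg V).
by apply: (chain_inj (bb1 _) (bb2 _) E); rewrite ?ne1 ?ne2 (negbTE pb).
Qed.

(** The behaviour of an answer names the answered event by itself, whereas that of the answered
    event binds it at level 0. The first two maps pass between these conventions; [shift] moves the
    first level from 0 to 1. *)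
Definition close_event a (z : nat + C) : nat + C :=
  if z is inr e then if e == a then inl 0 else z else z.
Definition open_event a (z : nat + C) : nat + C := if z is inl 0 then inr a else z.
Definition shift (z : nat + C) : nat + C := if z is inl i then inl i.+1 else z.

Lemma obeh_close n a b : neg a -> prec le a b -> obeh n.+1 a = tmap (close_event a) (pbeh n b).
Proof.
move=> na ab; rewrite /obeh otreeS (ans_prec leS na ab) /=; apply/esym.
apply: (ptree_bisim leS leS fC fC (view_bisim ml V V)) => //.
  by rewrite (seq_prec_neg leS ab) na.
move=> e1 e2 _ s1 s2 E; rewrite (chain_inj s1 s2 E) /set_env /=.
by case: eqP.
Qed.

Lemma occ_pbeh n b e : ~~ neg b -> occ (inr e) (pbeh n b) -> neg e /\ strict le e b.
Proof.
by move=> pb /(occ_ptree leS pb)[[e' [ne s [->]]]|[i //]].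
Qed.

Lemma occ_pbeh_le n a b e : neg a -> prec le a b -> occ (inr e) (pbeh n b) -> le e a.
Proof.
move=> na ab h; apply: (le_pred leS ab).
by case: (occ_pbeh _ h) => //; rewrite (seq_prec_neg leS ab) na.
Qed.

Lemma not_occ_pbeh0 n b : ~~ neg b -> ~ occ (inl 0) (pbeh n b).
Proof. by move=> pb /(occ_ptree leS pb)[[e' []]|[i []]]. Qed.

(** Level 0 does not occur in [pbeh n b], so [open_event] undoes [close_event]. *)
Lemma pbeh_open n a b : neg a -> prec le a b -> pbeh n b = tmap (open_event a) (obeh n.+1 a).
Proof.
move=> na ab; rewrite (obeh_close _ na ab) tmap_comp tmap_id_occ // => z.
have pb : ~~ neg b by rewrite (seq_prec_neg leS ab) na.
case: z => [[|i]|e] h //=; first by case: (not_occ_pbeh0 pb h).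
by case: eqP => // ->.
Qed.

Lemma otree_shift n x : neg x -> otree le n 1 (@inr nat C) x = tmap shift (obeh n x).
Proof.
move=> nx; apply/esym; apply: (otree_bisim leS leS fC fC (view_bisim ml V V)) => //.
by move=> e1 e2 _ s1 s2 E; rewrite (chain_inj s1 s2 E).
Qed.

(** All but [obeh n] on the right is read off the configuration: two orders that agree on [obeh n]
    agree on [pbeh n]. *)
Lemma pbeh_obeh n b : ~~ neg b -> pbeh n b =
  Answer (inr (just b)) (display b) (fun m => oapp (tmap shift \o obeh n) Silent (child b m)).
Proof.
move=> pb; rewrite /pbeh /ptree; congr Answer; apply: funext => m.
case E: (child b m) => [x|] //=; apply: otree_shift.
by have [] := child_seq leS pb E.
Qed.

Definition answered_by n t : {set C} :=
  [set a | neg a && oapp (fun b => `[<pbeh n b = t>]) false (ans le a)].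

Lemma answered_byP n t a : reflect (neg a /\ exists2 b, prec le a b & pbeh n b = t)
  (a \in answered_by n t).
Proof.
rewrite inE; apply: (iffP andP) => -[na].
  by case E: (ans le a) => [b|] //= /asboolP tb; split=> //; exists b => //; exact: ans_some.
by case=> b ab tb; rewrite (ans_prec leS na ab); split=> //; apply/asboolP.
Qed.

(** Every Player event answers exactly one Opponent event, which has no other answer. The right-hand
    side depends on the order only through [pbeh n]. *)
Lemma card_answered_by n t :
  #|answered_by n t| = #|[set b | ~~ neg b && `[<pbeh n b = t>]]|.
Proof.
have <- : [set odflt a (ans le a) | a in answered_by n t] =
    [set b | ~~ neg b && `[<pbeh n b = t>]].
  apply/setP => b; rewrite inE; apply/imsetP/andP.
    move=> [a /answered_byP[na [c ac tc]] ->]; rewrite (ans_prec leS na ac) /=.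
    by split; [rewrite (seq_prec_neg leS ac) na|apply/asboolP].
  move=> [pb /asboolP tb]; have [a na ab] := pos_seq_prec leS pb.
  exists a; last by rewrite (ans_prec leS na ab).
  by apply/answered_byP; split=> //; exists b.
rewrite card_in_imset // => x y /answered_byP[nx [b xb _]] /answered_byP[ny [c yc _]].
rewrite (ans_prec leS nx xb) (ans_prec leS ny yc) /= => E; rewrite E in xb.
exact: prec_inj (seqPO leS) (@seqF _ _ _ leS) _ _ _ xb yc.
Qed.

(** Since [a] and [y] behave alike, the answer to [y] behaves as [b] does with [y] substituted for
    [a]. *)
Lemma answered_fork n a y b : neg a -> prec le a b -> fork a y ->
  exists2 c, prec le y c & pbeh n c = tmap (open_event y) (tmap (close_event a) (pbeh n b)).
Proof.
move=> na ab f; have ny := fork_neg f.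
have E := fork_obeh n.+1 f; rewrite (obeh_close _ na ab) in E.
case Ec: (ans le y) => [c|]; last by move: E; rewrite /obeh otreeS Ec.
have yc := ans_some Ec; exists c => //.
by rewrite (pbeh_open n ny yc) -E.
Qed.

(** When [t] does not mention [a], the substitution of [y] for [a] leaves it unchanged. If [t]
    mentioned [y], then [y] would be below its sibling [a]. *)
Lemma answered_by_fork n t a y : a \in answered_by n t -> ~ occ (inr a) t ->
  fork a y -> y \in answered_by n t /\ ~ occ (inr y) t.
Proof.
move=> /answered_byP[na [b ab tb]] nocc f; have ny := fork_neg f.
have pb : ~~ neg b by rewrite (seq_prec_neg leS ab) na.
have [c yc tc] := answered_fork n na ab f.
rewrite tb (@tmap_id_occ _ _ (close_event a)) in tc; last first.
  by case=> // e h /=; case: eqP => // ea; rewrite ea in h.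
rewrite tmap_id_occ in tc; last first.
  by case=> // -[|//]; rewrite -tb => /(not_occ_pbeh0 pb).
split; first by apply/answered_byP; split=> //; exists c.
move=> oy; have := oy; rewrite -tb => /(occ_pbeh_le na ab)/(fork_le (fork_sym f)) E.
by rewrite E in oy.
Qed.

(** An event mentioned in [t] is below every event answered with behaviour [t], so [x] and [y] are
    below each other. *)
Lemma answered_by_occ_uniq n t x y : x \in answered_by n t ->
  y \in answered_by n t -> occ (inr x) t -> occ (inr y) t -> x = y.
Proof.
move=> /answered_byP[nx [b xb tb]] /answered_byP[ny [c yc tc]] ox oy.
rewrite -tc in ox; rewrite -tb in oy.
have [_ anti _] := seqPO leS; apply: anti.
by rewrite (occ_pbeh_le ny yc ox) (occ_pbeh_le nx xb oy).
Qed.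

(** An answer to the root has its justifier below the root, so it is justified by the root and
    mentions it. *)
Lemma answered_by_root n t x : x \in answered_by n t -> ~ occ (inr x) t ->
  ~ minimal (@cle A C) x.
Proof.
move=> /answered_byP[nx [b xb <-]] + mx; apply; rewrite /=; left; congr inr.
have := just_ans leS nx xb => /le_eqVstrict[//|s].
by case: (seq_minimal leS x) => _ /(_ mx)[]; exists (just b).
Qed.

End OneView.

(** * Comparing two expansions with the same configuration *)

(** Parity determines the lowest digit; the rest follows by halving. *)
Lemma binary_inj N (f g : nat -> bool) :
  \sum_(k < N) f k * 2 ^ k = \sum_(k < N) g k * 2 ^ k ->
  forall k, k < N -> f k = g k.
Proof.
elim: N f g => [|N IH] f g; first by move=> _ [].
have dbl (h : nat -> bool) : \sum_(k < N.+1) h k * 2 ^ k =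
    h 0 + (\sum_(k < N) h k.+1 * 2 ^ k).*2 :> nat.
  rewrite big_ord_recl muln1; congr addn; rewrite -muln2 big_distrl /=.
  by apply: eq_bigr => i _; rewrite expnSr mulnA.
rewrite (dbl f) (dbl g) => E.
have E0 : f 0 = g 0 by have := congr1 odd E; rewrite !oddD !odd_double !addbF !oddb.
move: E; rewrite E0 => /addnI/double_inj E [|k] // kN.
exact: (IH (f \o succn) (g \o succn) E k kN).
Qed.

(** * Unions of blocks whose sizes are distinct powers of two *)

Section FiberCount.
Context (T : finType) (G : {set T}) (kappa : T -> nat).
Hypothesis kappa_gt0 : forall x, x \in G -> 0 < kappa x.
Hypothesis fiber_card : forall x, x \in G ->
  #|[set y in G | kappa y == kappa x]| = 2 ^ kappa x.

Definition saturated (X : {set T}) : Prop := X \subset G /\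
  forall x y, x \in X -> y \in G -> kappa y = kappa x -> y \in X.

(** Digit 0 is free because [kappa] is positive on [G]; it records the possible extra element. *)
Definition bits (X : {set T}) (u : bool) (k : nat) : bool :=
  if k is 0 then u else [exists x in X, kappa x == k].

Lemma card_saturated N X (u : bool) : saturated X ->
  (forall x, x \in X -> kappa x < N) -> 0 < N ->
  #|X| + u = \sum_(k < N) bits X u k * 2 ^ k.
Proof.
case: N => // N [XG satX] XN _.
rewrite (bigD1 ord0) //= muln1 addnC; congr addn.
rewrite -sum1_card (partition_big (fun x => inord (kappa x) : 'I_N.+1) predT) //=.
rewrite (bigD1 ord0) //= big1 ?add0n => [|x /andP[xX /eqP/(congr1 val)/=]].
  apply: eq_bigr => k k0; have {k0} kgt0 : 0 < k.
    by rewrite lt0n; apply: contra k0 => /eqP h; apply/eqP/val_inj.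
  have bE : bits X u k = [exists x in X, kappa x == k] by case: (nat_of_ord k) kgt0.
  rewrite bE; case: existsP => [[x /andP[xX /eqP xk]]|nx].
    rewrite mul1n -[in RHS]xk -fiber_card ?(subsetP XG) // sum1_card.
    apply: eq_card => y; rewrite !inE; apply/andP/andP => -[yX /eqP yk]; split.
    - exact: (subsetP XG).
    - by rewrite xk -yk inordK // XN.
    - by apply: satX xX yX yk.
    - by apply/eqP/val_inj; rewrite yk xk inord_val.
  rewrite mul0n big1 // => x /andP[xX /eqP xk]; case: nx; exists x.
  by rewrite xX -xk inordK //= XN.
rewrite inordK ?XN // => k0.
by have := kappa_gt0 (subsetP XG _ xX); rewrite k0.
Qed.

Lemma saturated_inj X Y (u v : bool) : saturated X -> saturated Y ->
  #|X| + u = #|Y| + v -> X = Y /\ u = v.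
Proof.
move=> sX sY E; pose N := (\max_(x : T) kappa x).+1.
have ltN x : kappa x < N by rewrite ltnS; apply: leq_bigmax.
move: E; rewrite (card_saturated (N := N)) // (card_saturated (N := N) v sY) //.
move=> /binary_inj fg; split; last exact: (fg 0).
have sub X' Y' : saturated X' -> saturated Y' ->
    (forall k, 0 < k < N -> [exists x in X', kappa x == k] -> [exists x in Y', kappa x == k]) ->
    X' \subset Y'.
  move=> [XG _] [YG satY] h; apply/subsetP => x xX.
  have kx : 0 < kappa x < N by rewrite ltN kappa_gt0 // (subsetP XG).
  have ex : [exists z in X', kappa z == kappa x] by apply/existsP; exists x; rewrite xX /=.
  have /existsP[y /andP[yY /eqP xy]] := h _ kx ex.
  by apply: satY yY (subsetP XG _ xX) (esym xy).
apply/eqP; rewrite eqEsubset; apply/andP; split; apply: sub => // -[//|k] /= kN.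
  by have /= -> := fg k.+1 kN.
by have /= <- := fg k.+1 kN.
Qed.

End FiberCount.

Section TwoViews.
Context (A : arena) (C : configuration A).
Implicit Types a b e x y : C.
Hypothesis fC : full C.

(** The root is excluded because it cannot be duplicated. *)
Definition nonroot_neg : {set C} := [set x | neg x && ~~ `[<minimal (@cle A C) x>]].

Variable kappa : C -> nat.
Hypothesis kappa_gt0 : forall x, x \in nonroot_neg -> 0 < kappa x.
Hypothesis kappa_card : forall x, x \in nonroot_neg ->
  #|[set y in nonroot_neg | kappa y == kappa x]| = 2 ^ kappa x.
Hypothesis kappa_fork : forall x y, x \in nonroot_neg -> y \in nonroot_neg ->
  kappa x = kappa y <-> fork x y.

Lemma fork_mate x : x \in nonroot_neg -> exists2 y, fork x y & y <> x.
Proof.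
move=> xG; have := kappa_card xG; rewrite (cardsD1 x) inE xG eqxx /= => E.
have : 0 < #|[set y in nonroot_neg | kappa y == kappa x] :\ x|.
  have : 1 < 2 ^ kappa x by rewrite -[1](expn0 2) ltn_exp2l ?kappa_gt0.
  by rewrite -E.
case/card_gt0P => y; rewrite in_setD1 in_set => /and3P[/eqP yx yG /eqP E'].
by exists y => //; apply/kappa_fork.
Qed.

Lemma ans_saturated (le : rel C) (p : augmentation A) (phi : C -> p)
    (V : view le phi) (ml : minus_linear p) n t :
  saturated nonroot_neg kappa [set x in answered_by le n t | ~~ `[<occ (inr x) t>]].
Proof.
split.
  apply/subsetP => x /setIdP[xR /asboolP no]; rewrite in_set.
  have [nx _] := (answered_byP V _ _ _ xR); rewrite nx /=.
  by apply/asboolP; exact (answered_by_root V xR no).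
move=> x y /setIdP[xR /asboolP no] yG E; apply/setIdP.
have xG : x \in nonroot_neg.
  have [nx _] := (answered_byP V _ _ _ xR); rewrite inE nx /=.
  by apply/asboolP; exact (answered_by_root V xR no).
have [yR noy] := answered_by_fork V ml fC xR no (proj1 (kappa_fork xG yG) (esym E)).
by split=> //; apply/asboolP.
Qed.

Context (le1 le2 : rel C) (p1 p2 : augmentation A) (phi1 : C -> p1) (phi2 : C -> p2).
Hypotheses (V1 : view le1 phi1) (V2 : view le2 phi2).
Hypotheses (ml1 : minus_linear p1) (ml2 : minus_linear p2).

Lemma obeh_step n a b :
  (forall x, neg x -> obeh le1 n x = obeh le2 n x) ->
  neg a -> prec le1 a b -> obeh le1 n.+1 a = obeh le2 n.+1 a.
Proof.
move=> IH na ab.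
have eq_pbeh c : ~~ neg c -> pbeh le1 n c = pbeh le2 n c.
  move=> pc; rewrite (pbeh_obeh V1) // (pbeh_obeh V2 ml2 fC n pc); congr Answer.
  apply: funext => m; case E: (child c m) => [x|] //=; congr tmap; apply: IH.
  by have [] := child_seq (view_seq V1) pc E.
have cardE t : #|answered_by le1 n t| = #|answered_by le2 n t|.
  rewrite (card_answered_by V1) (card_answered_by V2); apply: eq_card => c.
  by rewrite !inE; case: (boolP (neg c)) => //= pc; rewrite eq_pbeh.
pose O (t : term (nat + C) A) := [set x : C | `[<occ (inr x) t>]].
(* At most one answered event is mentioned in [t], so each side counts a union of forks plus one
   bit; equal counts force equal forks and equal bits. *)
have match_sets t :
    [set x in answered_by le1 n t | ~~ `[<occ (inr x) t>]] =
    [set x in answered_by le2 n t | ~~ `[<occ (inr x) t>]] /\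
    (answered_by le1 n t :&: O t != set0) = (answered_by le2 n t :&: O t != set0).
  apply: (saturated_inj kappa_gt0 kappa_card (ans_saturated V1 ml1 n t)
    (ans_saturated V2 ml2 n t)).
  have split_card (le : rel C) (p : augmentation A) (phi : C -> p) : view le phi ->
      #|[set x in answered_by le n t | ~~ `[<occ (inr x) t>]]| +
      (answered_by le n t :&: O t != set0) = #|answered_by le n t|.
    move=> V; rewrite -[RHS](cardsID (O t)) addnC; congr addn; last first.
      by apply: eq_card => x; rewrite !in_set andbC.
    apply/esym; case: (set_0Vmem (answered_by le n t :&: O t)) => [->|[x]].
      by rewrite cards0 eqxx.
    move=> /setIP[xR]; rewrite in_set => /asboolP xo.
    have -> : answered_by le n t :&: O t = [set x].
      apply/setP => y; rewrite in_set1; apply/setIP/eqP.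
        move=> [yR]; rewrite in_set => /asboolP yo.
        exact (answered_by_occ_uniq V yR xR yo xo).
      by move=> ->; split=> //; rewrite in_set; apply/asboolP.
    by rewrite cards1; case: eqP => // /setP/(_ x); rewrite !inE eqxx.
  by rewrite (split_card _ _ _ V1) (split_card _ _ _ V2) cardE.
have obeh_match t x : x \in answered_by le1 n t -> x \in answered_by le2 n t ->
    obeh le1 n.+1 x = obeh le2 n.+1 x.
  move=> /(answered_byP V1)[nx [c xc tc]] /(answered_byP V2)[_ [d xd td]].
  by rewrite (obeh_close V1 ml1 fC n nx xc) (obeh_close V2 ml2 fC n nx xd) tc td.
have special t x : x \in answered_by le1 n t -> occ (inr x) t ->
    exists2 z, z \in answered_by le2 n t & occ (inr z) t.
  move=> xR xo; have [_ E] := match_sets t.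
  have : answered_by le2 n t :&: O t != set0.
    rewrite -E; apply/set0Pn; exists x; apply/setIP; split=> //.
    by rewrite in_set; apply/asboolP.
  by case/set0Pn => z /setIP[zR]; rewrite in_set => /asboolP zo; exists z.
set t := pbeh le1 n b.
have aR : a \in answered_by le1 n t by apply/(answered_byP V1); split=> //; exists b.
case: (pselect (occ (inr a) t)) => [ao|ano]; last first.
  apply: (obeh_match t) => //; have [/setP/(_ a) + _] := match_sets t.
  have : a \in [set x in answered_by le1 n t | ~~ `[<occ (inr x) t>]].
    by apply/setIdP; split=> //; apply/asboolP.
  by move=> + E; rewrite E => /setIdP[].
have [z zR zo] := special _ _ aR ao.
(* The root has no fork mate, but the witness [z] is below [a], so here it is [a] itself. *)
case: (pselect (minimal (@cle A C) a)) => [ma|nma].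
  have za := occ_pbeh_le V1 na ab zo.
  case: (le_eqVstrict za) => [E|s]; first by apply: (obeh_match t) => //; rewrite -E.
  by case: (seq_minimal (view_seq V1) a) => _ /(_ ma)[]; exists z.
have aG : a \in nonroot_neg by rewrite inE na; apply/asboolP.
(* The witness [z] may differ from [a]. The answer to a mate [y] has behaviour [t'], which is [t]
   with [y] for [a], and yields a second witness [z']. *)
have [y f ya] := fork_mate aG; have ny := fork_neg f.
have [c yc tc] := answered_fork V1 ml1 fC n na ab f.
set t' := pbeh le1 n c in tc.
have yR : y \in answered_by le1 n t' by apply/(answered_byP V1); split=> //; exists c.
have yo : occ (inr y) t'.
  have := occ_tmap (open_event y) (occ_tmap (close_event a) ao).
  by rewrite -tc /= eqxx.
have [z' zR' zo'] := special _ _ yR yo.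
(* If neither [a] nor its fork mate [y] were its own witness, then [z] and [z']
   would be distinct from them, hence mentioned in both [t] and [t'], hence each
   below the other: then [t = t'], and [y] would occur below its sibling [a]. *)
case: (eqVneq z a) => [E|za]; first by apply: (obeh_match t) => //; rewrite -E.
case: (eqVneq z' y) => [E|zy].
  rewrite (fork_obeh V1 ml1 fC _ f) (fork_obeh V2 ml2 fC _ f).
  by apply: (obeh_match t') => //; rewrite -E.
have zt' : occ (inr z) t'.
  have := occ_tmap (open_event y) (occ_tmap (close_event a) zo).
  by rewrite -tc /= (negbTE za).
(* Substituting back describes an answer to [a], which is [b] by determinism; hence [z'] occurs in
   [t]. *)
have [b' ab' tb'] := answered_fork V1 ml1 fC n ny yc (fork_sym f).
have bb' : b' = b.
  have := ans_prec (view_seq V1) na ab; rewrite (ans_prec (view_seq V1) na ab').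
  by case.
have z't : occ (inr z') t.
  have := occ_tmap (open_event a) (occ_tmap (close_event y) zo').
  by rewrite -tb' bb' /= (negbTE zy).
have [nz [d zd td]] := answered_byP V2 _ _ _ zR.
have [nz' [d' zd' td']] := answered_byP V2 _ _ _ zR'.
have zz' : z = z'.
  have [_ anti _] := seqPO (view_seq V2); apply: anti.
  rewrite -td in z't; rewrite -td' in zt'.
  by rewrite (occ_pbeh_le V2 nz' zd' zt') (occ_pbeh_le V2 nz zd z't).
have dd' : d' = d.
  rewrite -zz' in zd'; have := ans_prec (view_seq V2) nz zd.
  by rewrite (ans_prec (view_seq V2) nz zd'); case.
have tt' : t' = t by rewrite -td -td' dd'.
rewrite tt' in yo; have ya' := occ_pbeh_le V1 na ab yo.
by case: ya; apply: (fork_le V1 (fork_sym f) ya').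
Qed.

End TwoViews.

(** [obeh_step] starts from an answer in its first order; if only the second order has one, the
    roles are exchanged. *)
Lemma obeh_eq (A : arena) (C : configuration A) (kappa : C -> nat)
  (le1 le2 : rel C) (p1 p2 : augmentation A) (phi1 : C -> p1) (phi2 : C -> p2) :
  full C ->
  (forall x, x \in nonroot_neg C -> 0 < kappa x) ->
  (forall x, x \in nonroot_neg C ->
    #|[set y in nonroot_neg C | kappa y == kappa x]| = 2 ^ kappa x) ->
  (forall x y, x \in nonroot_neg C -> y \in nonroot_neg C ->
    kappa x = kappa y <-> fork x y) ->
  view le1 phi1 -> view le2 phi2 -> minus_linear p1 -> minus_linear p2 ->
  forall n a, neg a -> obeh le1 n a = obeh le2 n a.
Proof.
move=> fC k1 k2 k3 V1 V2 ml1 ml2; elim=> [//|n IH] a na.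
case E1: (ans le1 a) => [b|].
  exact: (obeh_step fC k1 k2 k3 V1 V2 ml1 ml2 IH na (ans_some E1)).
case E2: (ans le2 a) => [b|]; last by rewrite /obeh !otreeS E1 E2.
apply/esym/(obeh_step fC k1 k2 k3 V2 V1 ml2 ml1 _ na (ans_some E2)) => x nx.
exact/esym/IH.
Qed.

(** * An expansion whose forks have distinct cardinalities *)

Lemma suffixs_cons (T : eqType) (s t : seq T) x :
  suffix s (x :: t) = (s == x :: t) || suffix s t.
Proof.
apply/suffixP/orP => [[[|y u] /=]|[/eqP ->|/suffixP[u ->]]].
- by move=> ->; left.
- by case=> _ ->; right; apply/suffixP; exists u.
- by exists [::].
- by exists (x :: u).
Qed.

Lemma suffix_anti (T : eqType) (x y : seq T) : suffix x y -> suffix y x -> x = y.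
Proof.
move=> xy yx; have [u E] := suffixP xy; have := size_suffix yx.
by rewrite E size_cat -{2}[size x]add0n leq_add2r leqn0 size_eq0 => /eqP ->.
Qed.

Lemma suffix_total (T : eqType) (x y z : seq T) :
  suffix x z -> suffix y z -> suffix x y \/ suffix y x.
Proof.
elim: z x y => [|a z IH] x y; first by rewrite !suffixs0 => /eqP -> _; left; exact: suffix0s.
rewrite !suffixs_cons => /orP[/eqP ->|xz] /orP[/eqP ->|yz].
- by left; exact: suffix_refl.
- by right; rewrite suffixs_cons yz orbT.
- by left; rewrite suffixs_cons xz orbT.
- exact: IH.
Qed.

Section Duplication.
Context (A : arena) (p : augmentation A).
Hypotheses (recp : receptive p) (ml : minus_linear p).

Let pS := aug_seq p.
Let pPO := seqPO pS.
Let pF := @seqF _ _ _ pS.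

Lemma causal_full : full p.
Proof.
move=> b m nm bm; have [x [bx dx]] := recp nm bm; exists x; split=> //.
by apply: (seq_prec_dprec pS) => //; apply/is_negP; rewrite dx.
Qed.

Variable root : p.
Hypothesis root_min : minimal (@cle A p) root.

Let root_amin : minimal (@ale A p) root.
Proof. by apply/(seq_minimal pS). Qed.

(* Events of the duplicated strategy are paths from the root of [p], listed from
   the last event, where each event carries a copy number. The injection [pickle]
   makes the cardinalities of distinct forks distinct. *)
Definition copies (x : p) (s : seq (p * nat)) : nat :=
  if neg x then 2 ^ (pickle (x, s)).+1 else 1.

Fixpoint valid (s : seq (p * nat)) : bool :=
  if s is (x, i) :: s' then
    if s' is (y, _) :: _ then
      [&& `[<prec (@ale A p) y x>], i < copies x s' & valid s']
    else (x == root) && (i == 0)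
  else false.

Definition hd (s : seq (p * nat)) : p := (head (root, 0) s).1.

Lemma validE x i s : s != [::] ->
  valid ((x, i) :: s) = [&& `[<prec (@ale A p) (hd s) x>], i < copies x s & valid s].
Proof. by case: s => // -[]. Qed.

Lemma copies_gt0 x s : 0 < copies x s.
Proof. by rewrite /copies; case: ifP => // _; rewrite expn_gt0. Qed.

Lemma valid_suffix s t : valid t -> suffix s t -> s != [::] -> valid s.
Proof.
elim: t => [//|[x i] t IH] vt; rewrite suffixs_cons => /orP[/eqP -> //|st] s0.
have t0 : t != [::] by apply: contraNneq s0 => t0; move: st; rewrite t0 suffixs0.
by move: vt; rewrite validE // => /and3P[_ _ vt]; exact: IH.
Qed.

Lemma valid_hd_strict s t : valid t -> suffix s t -> s != [::] -> s != t ->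
  strict (@ale A p) (hd s) (hd t).
Proof.
elim: t => [//|[x i] t IH] vt; rewrite suffixs_cons => /orP[/eqP ->|st] s0.
  by rewrite eqxx.
have t0 : t != [::] by apply: contraNneq s0 => t0; move: st; rewrite t0 suffixs0.
move: vt; rewrite validE // => /and3P[/asboolP[tx _] _ vt] _.
case: (eqVneq s t) => [-> //|nst].
exact (strict_le_trans pPO (IH vt st s0 nst) (strictW tx)).
Qed.

(** A path lists the whole branch of [p] below its head. *)
Lemma valid_ancestor t z : valid t -> ale z (hd t) ->
  exists s, [/\ suffix s t, s != [::] & hd s = z].
Proof.
elim: t => [//|[x i] t IH] vt zx.
case: (le_eqVstrict zx) => [->|sz].
  by exists ((x, i) :: t); split=> //; rewrite suffix_refl.
case: (eqVneq t [::]) => [t0|t0].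
  move: vt sz; rewrite t0 /= => /andP[/eqP -> _] sz.
  by case: root_amin; exists z.
move: vt; rewrite validE // => /and3P[/asboolP tx _ vt].
have [s [st s0 sz']] := IH vt (prec_le pPO pF tx sz).
by exists s; split=> //; apply: suffix_trans st _; rewrite suffixs_cons suffix_refl orbT.
Qed.

Lemma valid_root t : valid t -> hd t = root -> t = [:: (root, 0)].
Proof.
case: t => [//|[x i] t]; case: (eqVneq t [::]) => [->|t0].
  by move=> /= /andP[/eqP -> /eqP ->].
rewrite validE // => /and3P[/asboolP[tx _] _ _] /= xr.
by case: root_amin; exists (hd t); rewrite -xr.
Qed.

Lemma suffix_root t : valid t -> suffix [:: (root, 0)] t.
Proof.
elim: t => [//|[x i] t IH]; case: (eqVneq t [::]) => [->|t0].
  by move=> /= /andP[/eqP -> /eqP ->]; rewrite suffix_refl.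
rewrite validE // => /and3P[_ _ vt].
by rewrite suffixs_cons IH // orbT.
Qed.

(** The events along a path form a strict chain; this bound makes the set of paths finite. *)
Lemma valid_size t : valid t -> size t <= #|p|.
Proof.
move=> vt; suff h : size t <= #|[set y | ale y (hd t)]| by apply: leq_trans h (max_card _).
elim: t vt => [//|[x i] t IH]; case: (eqVneq t [::]) => [->|t0] vt.
  apply/card_gt0P; exists x; rewrite inE /hd /=.
  by have [lexx _ _] := pPO; apply: lexx.
move: vt; rewrite validE // => /and3P[/asboolP[tx _] _ vt].
exact: leq_ltn_trans (IH vt) (card_down_strict pPO tx).
Qed.

(** A finite list containing all valid paths of length at most [n], among others that [path_event]
    filters out. *)
Fixpoint paths n : seq (seq (p * nat)) :=
  if n is n'.+1 then
    paths n' ++ [seq xi :: s | s <- paths n',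
       xi <- [seq (x, i) | x <- enum p, i <- iota 0 (copies x s)]]
  else [:: [::]].

Lemma paths_valid n t : valid t -> size t <= n -> t \in paths n.
Proof.
have nilP m : [::] \in paths m by elim: m => //= m IH; rewrite mem_cat IH.
elim: n t => [|n IH] [|[x i] t] //= vt tn; rewrite mem_cat; apply/orP; right.
have tP : t \in paths n.
  case: (eqVneq t [::]) => [-> //|t0]; apply: IH => //.
  by move: vt; rewrite -/(valid ((x, i) :: t)) validE // => /and3P[].
apply/allpairsPdep; exists t, (x, i); split=> //.
apply/allpairsPdep; exists x, i; split=> //; first by rewrite mem_enum.
rewrite mem_iota /= add0n; case: (eqVneq t [::]) => [t0|t0].
  by move: vt; rewrite t0 /= => /andP[_ /eqP ->]; exact: copies_gt0.
by move: vt; rewrite -/(valid ((x, i) :: t)) validE // => /and3P[].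
Qed.

Definition path_event : finType := seq_sub (filter valid (paths #|p|)).

Lemma path_event_mem t : (t \in filter valid (paths #|p|)) = valid t.
Proof.
rewrite mem_filter; case: (boolP (valid t)) => //= vt.
exact: (paths_valid vt (valid_size vt)).
Qed.

Lemma path_valid (s : path_event) : valid (val s).
Proof. by rewrite -path_event_mem; exact: valP. Qed.

Definition mkpath t (vt : valid t) : path_event :=
  SeqSub (etrans (path_event_mem t) vt).

Lemma path_neq0 (s : path_event) : val s != [::].
Proof. by case: (val s) (path_valid s). Qed.

Implicit Types s t u : path_event.

Definition phd s : p := hd (val s).
Definition pale s t : bool := suffix (val s) (val t).
Definition pcle s t : bool := suffix (val s) (val t) && cle (phd s) (phd t).

Lemma palePO : partial_order pale.
Proof.
split=> [s|s t /andP[st ts]|t s u]; first exact: suffix_refl.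
  exact/val_inj/suffix_anti.
exact: suffix_trans.
Qed.

Lemma pale_strict s t : strict pale s t -> strict (@ale A p) (phd s) (phd t).
Proof.
case/andP=> st sst; apply: valid_hd_strict => //; rewrite ?path_valid ?path_neq0 //.
Qed.

Lemma pcle_strict s t : strict pcle s t = pale s t && strict (@cle A p) (phd s) (phd t).
Proof.
rewrite /strict /pcle /pale; case: eqP => [->|/eqP st] /=; first by rewrite eqxx andbF.
case: (boolP (suffix _ _)) => //= sst.
by have /andP[-> _] : strict (@ale A p) (phd s) (phd t) by apply: pale_strict; apply/andP.
Qed.

Lemma pcle_pale s t : pcle s t -> pale s t.
Proof. by case/andP. Qed.

Lemma pclePO : partial_order pcle.
Proof.
have [lexx anti tr] := clePO p; have [plexx panti ptr] := palePO.
split=> [s|s t /andP[/pcle_pale st /pcle_pale ts]|t s u /andP[st h1] /andP[tu h2]].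
- by apply/andP; split; [exact: plexx|exact: lexx].
- by apply: panti; apply/andP.
- by rewrite /pcle (tr _ _ _ h1 h2) andbT; exact: (ptr t).
Qed.

Lemma rootP : valid [:: (root, 0)]. Proof. by rewrite /= !eqxx. Qed.
Definition proot : path_event := mkpath rootP.

Lemma phd_root s : phd s = root -> s = proot.
Proof. by move=> h; apply/val_inj/(valid_root (path_valid s)). Qed.

Lemma minimal_proot : minimal pale proot.
Proof. by move=> [s /pale_strict sr]; case: root_amin; exists (phd s). Qed.

Lemma minimal_pale s : minimal pale s <-> s = proot.
Proof.
split=> [ms|->]; last exact: minimal_proot.
apply: contrapT => ns; apply: ms; exists proot; rewrite /strict.
by rewrite eq_sym /pale suffix_root ?path_valid // andbT; apply/eqP.
Qed.

Lemma minimal_pcle s : minimal pcle s <-> s = proot.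
Proof.
split=> [ms|-> [t]]; last first.
  by rewrite pcle_strict => /andP[_ h]; case: root_min; exists (phd t).
apply: contrapT => ns; apply: ms; exists proot.
rewrite pcle_strict /pale suffix_root ?path_valid //= /strict.
rewrite (least_root _ (cle_tree p) root_min) andbT.
by apply/eqP => /esym/phd_root.
Qed.

Lemma pale_prec s t : prec pale s t <-> exists xi, val t = xi :: val s.
Proof.
split=> [[/andP[nst st] nbt]|[[x i] E]].
  have vt := path_valid t; move: st; rewrite /pale.
  case Et: (val t) vt => [//|[x i] t'] vt; rewrite suffixs_cons => /orP[/eqP E|st].
    by case/negP: nst; apply/eqP/val_inj; rewrite E.
  exists (x, i); congr cons; apply: contrapT => ns; apply: nbt.
  have t0 : t' != [::].
    by apply: contraNneq (path_neq0 s) => t0; move: st; rewrite t0 suffixs0.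
  move: vt; rewrite validE // => /and3P[_ _ vt'].
  exists (mkpath vt'); rewrite /strict /pale /= st Et suffixs_cons suffix_refl orbT !andbT.
  split; first by apply/eqP => E; apply: ns; rewrite E.
  apply/eqP => /(congr1 val); rewrite /= Et => /(congr1 size) /= /eqP.
  by rewrite eqn_leq ltnn andbF.
have st : strict pale s t.
  rewrite /strict /pale E suffixs_cons suffix_refl orbT andbT.
  by apply/eqP => /(congr1 val); rewrite E => /(congr1 size) /= /eqP;
    rewrite eqn_leq ltnn andbF.
split=> // -[u [/andP[su suu] /andP[ut uut]]].
move: uut; rewrite /pale E suffixs_cons => /orP[/eqP h|h].
  by case/negP: ut; apply/eqP/val_inj; rewrite E.
by case/negP: su; apply/eqP/val_inj/suffix_anti.
Qed.

Lemma pale_prec_hd s t : prec pale s t -> prec (@ale A p) (phd s) (phd t).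
Proof.
move=> /pale_prec[[x i] E]; have := path_valid t.
by rewrite /phd E validE ?path_neq0 // => /and3P[/asboolP].
Qed.

Lemma path_extend s x : prec (@ale A p) (phd s) x ->
  exists2 t, prec pale s t & phd t = x.
Proof.
move=> sx; have v : valid ((x, 0) :: val s).
  rewrite validE ?path_neq0 //; apply/and3P.
  by split; [exact/asboolP|exact: copies_gt0|exact: path_valid].
by exists (mkpath v) => //; apply/pale_prec; exists (x, 0).
Qed.

Lemma paleF : forest_shaped pale.
Proof. by move=> s t u; exact: suffix_total. Qed.

Lemma pale_below_hd t z : ale z (phd t) -> exists2 s, pale s t & phd s = z.
Proof.
move=> /(valid_ancestor (path_valid t))[s [st s0 sz]].
by exists (mkpath (valid_suffix (path_valid t) st s0)).
Qed.

Lemma pcle_prec s t : prec pcle s t <-> pale s t /\ prec (@cle A p) (phd s) (phd t).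
Proof.
split=> [[]|[st [sst nb]]].
  rewrite pcle_strict => /andP[st sst] nb; split=> //; split=> // -[z [sz zt]].
  (* An event of [p] in between lies on the branch of [t], so it is the head of a suffix [u] of
     [t]. *)
  have [u ut uz] := pale_below_hd (strictW (seq_strict pS zt)).
  apply: nb; exists u; rewrite !pcle_strict uz sz zt ut !andbT; split=> //.
  case: (paleF st ut) => // us.
  have h : ale z (phd s).
    case: (le_eqVstrict us) => [<-|/pale_strict/strictW]; last by rewrite uz.
    by rewrite uz; have [lexx _ _] := pPO; apply: lexx.
  by have /(strict_le_trans pPO)/(_ h)/strict_irr := seq_strict pS sz.
split; first by rewrite pcle_strict st.
move=> [u []]; rewrite !pcle_strict => /andP[_ su] /andP[_ ut].
by apply: nb; exists (phd u).
Qed.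

Lemma pcle_tree : is_tree pcle.
Proof.
split; first exact: pclePO.
  move=> s t u /andP[su hsu] /andP[tu htu].
  have [lexx anti tr] := clePO p.
  have wlog_case s' t' : pale s' t' -> cle (phd s') (phd u) -> cle (phd t') (phd u) ->
      pcle s' t'.
    move=> st h1 h2; rewrite /pcle; apply/andP; split=> //.
    case: (@cleF _ p _ _ _ h1 h2) => // h.
    case: (le_eqVstrict st) => [->|/pale_strict h']; first exact: lexx.
    by have /(strict_irr) := strict_le_trans pPO h' (seq_rule pS h).
  by case: (paleF su tu) => h; [left|right]; apply: wlog_case.
exists proot; split=> [|s]; first exact/minimal_pcle.
by move/minimal_pcle.
Qed.

Lemma pale_tree : is_tree pale.
Proof.
split; [exact: palePO|exact: paleF|].
by exists proot; split=> [|s]; [exact: minimal_proot|move/minimal_pale].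
Qed.

Definition dup_config : configuration A.
refine (@Configuration A path_event pcle (fun s => display (phd s)) pcle_tree _ _).
  move=> s; split=> [/minimal_pcle ->|/display_minimal ms]; first exact/display_minimal.
  by apply/minimal_pcle/phd_root; rewrite (minimal_inj (cle_tree p) root_min ms).
by move=> s t /pcle_prec[_ /display_prec].
Defined.

Definition dup : augmentation A.
refine (@Augmentation A dup_config pale pale_tree _ _ _).
- exact: pcle_pale.
- move=> s t st h; apply/pcle_prec; split; first by case: st => /andP[].
  exact (seq_court pS (pale_prec_hd st) h).
- move=> s t u ns pt pu st su; have E := seq_det pS ns pt pu (pale_prec_hd st) (pale_prec_hd su).
  (* Player events have a single copy, numbered 0, so determinism is inherited from [p]. *)
  have zero (t' : path_event) : pol (display (phd t')) = Pos -> prec pale s t' ->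
      val t' = (phd t', 0) :: val s.
    move=> /is_posP pt' /pale_prec[[x i] Et]; have := path_valid t'; move: pt'.
    rewrite /phd Et validE ?path_neq0 // => pt' /and3P[_ + _].
    by rewrite /copies /hd /= (negbTE pt') ltnS leqn0 => /eqP ->.
  by apply: val_inj; rewrite (zero t) // (zero u) // E.
Defined.

Lemma dup_view : view (@ale A dup) (phd : dup -> p).
Proof.
split=> //; first exact: aug_seq.
- exact: pale_prec_hd.
- by move=> s t /pcle_prec[].
by move=> s b _ /path_extend.
Qed.

Lemma dup_full : full dup.
Proof.
move=> s m nm bm; have [x [sx dx]] := @causal_full (phd s) m nm bm.
have ax : prec (@ale A p) (phd s) x.
  by apply: (dprec_seq_prec pS) => //; apply/is_negP; rewrite dx.
have [t st tx] := path_extend ax.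
exists t; split; last by rewrite -dx -tx.
by apply/(pcle_prec _ _); rewrite tx; split=> //; case: st => /andP[].
Qed.

(** The exponent used in [copies], with the last copy number forgotten. *)
Definition dup_kappa (s : dup) : nat :=
  (pickle (phd s, behead (val s))).+1.

Lemma dup_nonroot (s : dup) : s \in nonroot_neg dup ->
  neg (phd s) /\ exists (r : dup), prec pale r s.
Proof.
rewrite inE => /andP[ns /asboolP mr]; split=> //.
case: (minimal_or_prec palePO s) => [/minimal_pale ms|//].
by case: mr; apply/minimal_pcle.
Qed.

Lemma dup_forkE (s t : dup) : s \in nonroot_neg dup -> t \in nonroot_neg dup ->
  dup_kappa s = dup_kappa t <-> fork s t.
Proof.
move=> sG tG; have [ns [r rs]] := dup_nonroot sG; have [nt [r' rt]] := dup_nonroot tG.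
have drs := seq_prec_dprec (aug_seq dup) (ns : neg (s : dup)) rs.
have drt := seq_prec_dprec (aug_seq dup) (nt : neg (t : dup)) rt.
have [xi Es] := proj1 (pale_prec _ _) rs; have [yj Et] := proj1 (pale_prec _ _) rt.
rewrite /dup_kappa Es Et /=; split.
  case=> /(pcan_inj pickleK)[hst /val_inj E].
  by split; [exact: ns|rewrite /= hst|exists r; rewrite {2}E].
move=> [_ dst [b [bs bt]]].
have rb : r = b := prec_inj (clePO dup) (@cleF _ dup) drs bs.
have rb' : r' = b := prec_inj (clePO dup) (@cleF _ dup) drt bt.
rewrite rb' -rb; congr (pickle (_, _)).+1.
(* Equal labels above the same predecessor come from the same event of [p], by $-$-linearity. *)
apply: (ml (a := phd r)) => //.
- exact/is_negP.
- exact/is_negP.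
- exact: (pale_prec_hd rs).
- by rewrite rb -rb'; exact: (pale_prec_hd rt).
Qed.

Lemma dup_kappa_card (s : dup) : s \in nonroot_neg dup ->
  #|[set t in nonroot_neg dup | dup_kappa t == dup_kappa s]| = 2 ^ dup_kappa s.
Proof.
move=> sG; have [ns [r rs]] := dup_nonroot sG.
have [[x i] Es] := proj1 (pale_prec _ _) rs.
have hx : phd s = x by rewrite /phd Es.
have cE : copies x (val r) = 2 ^ dup_kappa s.
  by rewrite /copies -hx ns /dup_kappa Es.
(* The fork of [s] consists of the extensions of [r] by [x], one for each copy number [j]. *)
have vj (j : 'I_(2 ^ dup_kappa s)) : valid ((x, nat_of_ord j) :: val r).
  rewrite validE ?path_neq0 //; apply/and3P.
  by split; [rewrite -hx; exact/asboolP/(pale_prec_hd rs)|rewrite cE|exact: path_valid].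
pose f j : dup := mkpath (vj j).
have -> : [set t in nonroot_neg dup | dup_kappa t == dup_kappa s] = f @: setT.
  apply/setP => t; apply/setIdP/imsetP.
    move=> [tG /eqP E]; have [nt [r' rt]] := dup_nonroot tG.
    have [[y j] Et] := proj1 (pale_prec _ _) rt.
    have hy : phd t = y by rewrite /phd Et.
    have [h1 h2] : phd t = phd s /\ r' = r.
      by move: E; rewrite /dup_kappa Es Et /= => -[/(pcan_inj pickleK)[? /val_inj]].
    have jlt : j < 2 ^ dup_kappa s.
      have := path_valid t; rewrite Et validE ?path_neq0 // => /and3P[_ + _].
      by rewrite -hy h1 hx h2 cE.
    exists (Ordinal jlt) => //; apply: val_inj.
    by rewrite /= Et h2 -hy h1 hx.
  move=> [j _ ->]; have rf : prec pale r (f j) by apply/pale_prec; exists (x, nat_of_ord j).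
  split; last by rewrite /dup_kappa Es /= hx.
  rewrite inE; apply/andP; split; first by rewrite /neg /= /phd /= -hx.
  apply/asboolP => /minimal_pcle h; rewrite h in rf.
  by have := prec_not_minimal rf; apply; exact: minimal_proot.
rewrite card_imset ?cardsT ?card_ord // => j k /(congr1 val) /= [E].
exact: val_inj.
Qed.

End Duplication.

(** * Reconstructing the isomorphism *)

Lemma config_iso_refl (A : arena) (x : configuration A) : config_iso x x.
Proof. by exists id; split=> //; exists id. Qed.

Lemma morphism_view (A : arena) (q p : augmentation A) (phi : q -> p) :
  morphism phi -> plus_obsessional phi -> view (@ale A q) phi.
Proof.
move=> [md ma mD] obs; split=> //; first exact: aug_seq.
move=> a b na ab; have pb : epol b = Pos.
  apply/is_posP; rewrite (seq_prec_neg (aug_seq p) ab) negbK /neg md.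
  exact: na.
by have [a' [aa' <-]] := obs a b (elimT (is_negP a) na) pb ab; exists a'.
Qed.

(** * Transport of a causal order along an isomorphism of configurations *)

Section Transport.
Context (A : arena) (C : configuration A) (q p : augmentation A).
Context (theta : C -> q) (phi : q -> p).
Hypotheses (theta_bij : bijective theta)
  (theta_display : forall a, display (theta a) = display a)
  (theta_prec : forall a b, prec (@cle A C) a b <-> prec (@cle A q) (theta a) (theta b)).
Hypothesis V : view (@ale A q) phi.

Definition pull_le : rel C := fun x y => ale (theta x) (theta y).

Let theta_inj : injective theta. Proof. exact: bij_inj. Qed.

Lemma pull_strict a b : strict pull_le a b = strict (@ale A q) (theta a) (theta b).
Proof. by rewrite /strict (inj_eq theta_inj). Qed.

Lemma pull_minimal a : minimal pull_le a <-> minimal (@ale A q) (theta a).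
Proof.
have [inv _ invK] := theta_bij; split=> ma [b]; last first.
  by rewrite pull_strict => ba; apply: ma; exists (theta b).
by rewrite -[b]invK -pull_strict => ba; apply: ma; exists (inv b).
Qed.

Lemma pull_prec a b : prec pull_le a b <-> prec (@ale A q) (theta a) (theta b).
Proof.
have [inv _ invK] := theta_bij; rewrite /prec pull_strict.
split=> -[ab nb]; split=> // -[c]; last first.
  by rewrite !pull_strict => h; apply: nb; exists (theta c).
by rewrite -[c]invK -!pull_strict => h; apply: nb; exists (inv c).
Qed.

Lemma pull_seq : sequentialization pull_le.
Proof.
have qS := aug_seq q; have [lexx anti tr] := seqPO qS.
have [inv invK thetaK] := theta_bij; split.
- split.
  + split=> [x|x y xy|x y z]; [exact: lexx|exact/theta_inj/anti|exact: tr].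
  + by move=> x y z; apply: (seqF qS).
  + have [_ _ [r [mr ur]]] := seq_tree qS; exists (inv r); split.
      by apply/pull_minimal; rewrite thetaK.
    by move=> x /pull_minimal/ur ->; rewrite invK.
- move=> a b ab; case: (le_eqVstrict ab) => [->|s]; first exact: lexx.
  apply: (seq_rule qS); apply: strictW.
  exact: (prec_strict_morph (clePO C) (clePO q) (fun a b => proj1 (theta_prec a b))).
- move=> a b /pull_prec ab; rewrite -!theta_display => h.
  by apply/theta_prec; apply: (seq_court qS ab h).
- move=> a b c na pb pc /pull_prec ab /pull_prec ac; apply: theta_inj.
  by apply: (seq_det qS _ _ _ ab ac); rewrite theta_display.
Qed.

Lemma pull_view : view pull_le (phi \o theta).
Proof.
have [inv invK thetaK] := theta_bij; split.
- exact: pull_seq.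
- by move=> a; rewrite /= (view_display V).
- by move=> a b /pull_prec; exact: (view_prec V).
- by move=> a b /theta_prec; exact: (view_dprec V).
move=> a b na ab; have na' : neg (theta a) by rewrite /neg theta_display.
have [c ac cb] := view_obs V na' ab; exists (inv c); last by rewrite /= thetaK.
by apply/pull_prec; rewrite thetaK.
Qed.

End Transport.

(** * Unfoldings without free names *)

Section Depth.
Context (A : arena) (C : configuration A) (le : rel C).
Hypothesis leS : sequentialization le.
Implicit Types a b e x y : C.

(** For an Opponent event, the level at which [otree], started at level 0 from the root, binds
    it. *)
Definition depth x := #|[set e | neg e && strict le e x]|.

Lemma depth_prec a b : prec le a b -> depth b = neg a + depth a.
Proof.
move=> ab; have st e : strict le e b = (e == a) || strict le e a.
  apply/idP/orP => [eb|[/eqP ->|ea]]; last 2 first.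
  - by case: ab.
  - by apply: (strict_le_trans (seqPO leS) ea); apply: strictW; case: ab.
  by case: (le_eqVstrict (le_pred leS ab eb)) => [->|]; [left|right].
rewrite /depth; case: (boolP (neg a)) => na.
  rewrite (cardsD1 a) inE na st eqxx /=; congr _.+1; apply: eq_card => e.
  rewrite !inE st; case: eqP => //= -> ; rewrite na.
  by apply/esym/negP; exact: strict_irr.
apply: eq_card => e; rewrite !inE st; case: eqP => //= ->; rewrite (negbTE na) //.
Qed.

Lemma depth_inj e e' :
  neg e -> neg e' -> le e e' \/ le e' e -> depth e = depth e' -> e = e'.
Proof.
have lt x y : neg x -> strict le x y -> depth x < depth y.
  move=> nx xy; apply: proper_card; apply/properP; split.
    apply/subsetP => z; rewrite !inE => /andP[-> zx] /=.
    exact (strict_le_trans (seqPO leS) zx (strictW xy)).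
  exists x; rewrite !inE nx ?xy //=; apply/negP; exact: strict_irr.
move=> ne ne' + E; case=> /le_eqVstrict[//|s].
  by have := lt _ _ ne s; rewrite E ltnn.
by have := lt _ _ ne' s; rewrite E ltnn.
Qed.

Definition denv x : nat + void := inl (depth x).

(** Hence one environment serves the whole unfolding. *)
Lemma set_denv a : set_env denv a (depth a) = denv.
Proof. by apply: funext => e; rewrite /set_env; case: eqP => // ->. Qed.

Definition unfold n x : term (nat + void) A :=
  if neg x then otree le n (depth x) denv x else ptree le n (depth x) denv x.

Lemma unfold_neg n a b : neg a -> prec le a b -> unfold n.+1 a = unfold n b.
Proof.
move=> na ab; rewrite /unfold na (seq_prec_neg leS ab) na [LHS]otreeS.
by rewrite (ans_prec leS na ab) /= set_denv (depth_prec ab) na.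
Qed.

Lemma unfold_none n a : neg a -> ans le a = None -> unfold n a = Silent.
Proof. by move=> na h; rewrite /unfold na; case: n => // n; rewrite otreeS h. Qed.

Lemma unfold_pos n b : ~~ neg b -> unfold n b =
  Answer (denv (just b)) (display b) (fun m => oapp (unfold n) Silent (child b m)).
Proof.
move=> pb; rewrite /unfold (negbTE pb) /ptree; congr Answer; apply: funext => m.
case E: (child b m) => [x|] //=; have [nx bx] := child_seq leS pb E.
by rewrite nx (depth_prec bx) (negbTE pb).
Qed.

End Depth.

Lemma causal_child (A : arena) (p : augmentation A) (b x : p) :
  minus_linear p -> ~~ neg b -> prec (@ale A p) b x -> child b (display x) = Some x.
Proof.
move=> ml pb bx; have pS := aug_seq p.
have nx : neg x by rewrite (seq_prec_neg pS bx).
case E: (child b (display x)) => [y|]; last first.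
  by case: (child_none E (seq_prec_dprec pS nx bx)).
have [ny bY] := child_seq pS pb E; have [_ dy] := child_some E; congr Some.
by apply: (ml b) => //; apply/is_negP.
Qed.

(** * Matching the events of two strategies with equal unfoldings *)

Section Matching.
Context (A : arena).

(** The graph of the future isomorphism, before it is known to be a function. *)
Inductive matched (p1 p2 : augmentation A) : p1 -> p2 -> Prop :=
| matched_root r1 r2 : minimal (@ale A p1) r1 -> minimal (@ale A p2) r2 ->
    matched r1 r2
| matched_step x1 x2 y1 y2 : matched x1 x2 -> prec (@ale A p1) x1 y1 ->
    prec (@ale A p2) x2 y2 -> display y1 = display y2 -> matched y1 y2.

Lemma matched_sym (p1 p2 : augmentation A) (x1 : p1) (x2 : p2) :
  matched x1 x2 -> matched x2 x1.
Proof.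
elim=> [r1 r2 m1 m2|x y x' y' _ IH h1 h2 d]; first exact: matched_root.
exact: (matched_step IH h2 h1 (esym d)).
Qed.

Lemma matched_inj (p1 p2 : augmentation A) (x : p1) (y z : p2) : minus_linear p2 ->
  matched x y -> matched x z -> y = z.
Proof.
move=> ml xy; have S1 := aug_seq p1; have S2 := aug_seq p2; elim: xy z => {x y}.
  move=> r1 r2 m1 m2 z h; case: h m1 => [r s ms mz _|x1 x2 y1 y2 _ h _ _ m].
    exact: (minimal_inj (seq_tree S2)).
  by have := prec_not_minimal h m.
move=> x1 x2 y1 y2 _ IH h1 h2 d z h; case: h h1 d => [r s mr _ h1|u v w z' uv uw vz d' h1 d].
  by have := prec_not_minimal h1 mr.
have E := prec_inj (seqPO S1) (@seqF _ _ _ S1) h1 uw; rewrite -E in uv.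
rewrite -(IH _ uv) in vz; have dz : display y2 = display z' by rewrite -d -d'.
case: (boolP (neg x2)) => n2.
  have := ans_prec S2 n2 h2; rewrite (ans_prec S2 n2 vz); by case.
have := causal_child ml n2 h2; rewrite dz (causal_child ml n2 vz); by case.
Qed.

Lemma matched_below (p1 p2 : augmentation A) (x e : p1) (y : p2) :
  matched x y -> ale e x ->
  exists2 e', ale e' y & matched e e'.
Proof.
have S1 := aug_seq p1; have S2 := aug_seq p2; have [lexx _ tr] := seqPO S2.
move=> xy; elim: xy e => {x y} [r1 r2 m1 m2|x1 x2 y1 y2 xx IH h1 h2 d] e.
  move=> /le_eqVstrict[->|s]; last by case: m1; exists e.
  by exists r2; [exact: lexx|exact: matched_root].
move=> /le_eqVstrict[->|s]; first by exists y2; [exact: lexx|exact (matched_step xx h1 h2 d)].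
have [e' h m] := IH e (le_pred S1 h1 s); exists e' => //.
by apply: (tr _ _ _ h); apply: strictW; case: h2.
Qed.

Section Unfoldings.
Context (p1 p2 : augmentation A).
Hypotheses (ml1 : minus_linear p1) (ml2 : minus_linear p2).
Hypothesis rec2 : receptive p2.
Hypothesis roots : forall r1 r2, minimal (@ale A p1) r1 -> minimal (@ale A p2) r2 ->
  forall n, unfold (@ale A p1) n r1 = unfold (@ale A p2) n r2.

Let S1 := aug_seq p1.
Let S2 := aug_seq p2.

Lemma minimal_display r1 r2 : minimal (@ale A p1) r1 -> minimal (@ale A p2) r2 ->
  display r1 = display r2.
Proof.
move=> /(seq_minimal S1)/display_minimal m1 /(seq_minimal S2)/display_minimal m2.
by case: (arena_well_opened A) => m [_ um]; rewrite -(um _ m1) -(um _ m2).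
Qed.

Lemma matched_display (x : p1) (y : p2) : matched x y -> display x = display y.
Proof. by case=> // r1 r2; exact: minimal_display. Qed.

Lemma matched_neg (x : p1) (y : p2) : matched x y -> neg x = neg y.
Proof. by move=> /matched_display; rewrite /neg => ->. Qed.

Lemma depth_root (p : augmentation A) (r : p) : minimal (@ale A p) r ->
  depth (@ale A p) r = 0.
Proof.
move=> mr; apply/eqP; rewrite cards_eq0; apply/eqP/setP => e; rewrite !inE.
by apply/negP => /andP[_ er]; apply: mr; exists e.
Qed.

Lemma matched_depth (x : p1) (y : p2) : matched x y ->
  depth (@ale A p1) x = depth (@ale A p2) y.
Proof.
elim=> [r1 r2 m1 m2|x1 x2 y1 y2 xx IH h1 h2 _]; first by rewrite !depth_root.
by rewrite (depth_prec S1 h1) (depth_prec S2 h2) IH (matched_neg xx).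
Qed.

(** Passing from an Opponent event to its answer uses up one unit of [n], hence the statement for
    all [n]. *)
Lemma matched_unfold (x : p1) (y : p2) : matched x y ->
  forall n, unfold (@ale A p1) n x = unfold (@ale A p2) n y.
Proof.
elim=> [r1 r2|x1 x2 y1 y2 xx IH h1 h2 d n]; first exact: roots.
case: (boolP (neg x1)) => n1; have n2 := n1; rewrite (matched_neg xx) in n2.
  by rewrite -(unfold_neg S1 n n1 h1) -(unfold_neg S2 n n2 h2).
have := IH n; rewrite (unfold_pos S1) // (unfold_pos S2) // => -[_ _].
move=> /(congr1 (fun f => f (display y1))).
by rewrite (causal_child ml1 n1 h1) d (causal_child ml2 n2 h2).
Qed.

Lemma matched_prec (x y : p1) (x' : p2) : matched x x' -> prec (@ale A p1) x y ->
  exists2 y', prec (@ale A p2) x' y' & matched y y'.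
Proof.
move=> xx xy; case: (boolP (neg x)) => nx; have nx' := nx; rewrite (matched_neg xx) in nx'.
  have py : ~~ neg y by rewrite (seq_prec_neg S1 xy) nx.
  case E: (ans (@ale A p2) x') => [y'|]; last first.
    (* One unit of unfolding already separates an answer from [Silent]. *)
    have := matched_unfold xx 1; rewrite (unfold_neg S1 0 nx xy).
    by rewrite (unfold_none 1 nx' E) (unfold_pos S1).
  have xy' : prec (@ale A p2) x' y' := ans_some E.
  exists y' => //; apply: (matched_step xx xy xy').
  have py' : ~~ neg y' by rewrite (seq_prec_neg S2 xy') nx'.
  have := matched_unfold xx 1; rewrite (unfold_neg S1 0 nx xy) (unfold_neg S2 0 nx' xy').
  by rewrite (unfold_pos S1) // (unfold_pos S2) // => -[].
have ny : neg y by rewrite (seq_prec_neg S1 xy).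
have [y' [xy' dy']] : exists y' : p2, aprec x' y' /\ display y' = display y.
  apply: rec2; first exact/is_negP.
  by rewrite -(matched_display xx); apply/display_prec/(seq_prec_dprec S1 ny xy).
by exists y' => //; apply: matched_step xx xy xy' (esym dy').
Qed.

Lemma matched_total (x : p1) : exists y : p2, matched x y.
Proof.
elim/(strict_ind (seqPO S1)): x => x IH.
case: (minimal_or_prec (seqPO S1) x) => [mx|[w wx]].
  have [_ _ [r [mr _]]] := seq_tree S2; exists r; exact: matched_root.
have [w' ww] := IH w (proj1 wx).
by have [x' _ xx] := matched_prec ww wx; exists x'.
Qed.

(** The unfolding records the depth of the justifier, and on a branch the depth identifies an
    Opponent event. *)
Lemma matched_just (x : p1) (y : p2) : ~~ neg x -> matched x y ->
  matched (just x) (just y).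
Proof.
move=> px xy; have py : ~~ neg y by rewrite -(matched_neg xy).
have [e ey je] := matched_below xy (strictW (just_strict S1 px)).
suff -> : just y = e by [].
have ne : neg e by rewrite -(matched_neg je) just_neg.
apply: (depth_inj S2); rewrite ?just_neg //.
  by apply: (seqF S2 _ ey); exact: strictW (just_strict S2 py).
rewrite -(matched_depth je); have := matched_unfold xy 0.
by rewrite (unfold_pos S1) // (unfold_pos S2) // => -[].
Qed.

Lemma matched_morphism (f : p1 -> p2) : (forall x, matched x (f x)) -> morphism f.
Proof.
move=> fm; have fprec a b : prec (@ale A p1) a b -> prec (@ale A p2) (f a) (f b).
  move=> ab; have [y' h m] := matched_prec (fm a) ab.
  by rewrite (matched_inj ml2 (fm b) m).
split=> [a|//|a b ab]; first by rewrite -(matched_display (fm a)).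
case: (boolP (neg b)) => nb.
  apply: (seq_prec_dprec S2); first by rewrite -(matched_neg (fm b)).
  exact/fprec/(dprec_seq_prec S1 nb ab).
rewrite -(just_eq ab) (matched_inj ml2 (fm _) (matched_just nb (fm b))).
by apply: just_prec; rewrite -(matched_neg (fm b)).
Qed.

End Unfoldings.

Lemma isomorphic_of_unfold (p1 p2 : augmentation A) :
  causal_strategy p1 -> causal_strategy p2 ->
  (forall r1 r2, minimal (@ale A p1) r1 -> minimal (@ale A p2) r2 ->
    forall n, unfold (@ale A p1) n r1 = unfold (@ale A p2) n r2) ->
  isomorphic p1 p2.
Proof.
move=> [rec1 ml1] [rec2 ml2] roots.
have roots' r2 r1 : minimal (@ale A p2) r2 -> minimal (@ale A p1) r1 ->
    forall n, unfold (@ale A p2) n r2 = unfold (@ale A p1) n r1.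
  by move=> m2 m1 n; rewrite (roots r1 r2).
have [f fm] := choice (matched_total ml1 ml2 rec2 roots).
have [g gm] := choice (matched_total ml2 ml1 rec1 roots').
exists f, g; split.
- exact: (matched_morphism ml1 ml2 rec2 roots fm).
- exact: (matched_morphism ml2 ml1 rec1 roots' gm).
- by move=> x; apply: (matched_inj ml1 (gm _)); exact: matched_sym.
- by move=> x; apply: (matched_inj ml2 (fm _)); exact: matched_sym.
Qed.

End Matching.

(** The root of [C] is bisimilar to that of [p]. The renaming of free events to [inl 0] is a junk
    value: nothing lies below the root, so none occurs. *)
Lemma view_unfold (A : arena) (C : configuration A) (le : rel C) (p : augmentation A)
    (phi : C -> p) (r : C) (s : p) n : causal_strategy p -> full C -> view le phi ->
  minimal (@cle A C) r -> minimal (@ale A p) s ->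
  unfold (@ale A p) n s =
    tmap (fun z : nat + C => if z is inl i then inl i else inl 0) (obeh le n r).
Proof.
move=> [recp ml] fC V mr ms; have pS := aug_seq p.
have rs : phi r = s.
  apply: (minimal_inj (seq_tree pS)) => //; apply/(seq_minimal pS)/display_minimal.
  by rewrite (view_display V); apply/display_minimal.
have ns : neg s by rewrite -rs (view_neg V) (root_neg mr).
rewrite /unfold ns depth_root //; apply/esym.
apply: (otree_bisim (view_seq V) pS fC (causal_full recp) (view_bisim ml V (view_id p))) => //.
  exact: root_neg.
by move=> e1 e2 _ s1; case: (seq_minimal (view_seq V) r) => _ /(_ mr)[]; exists e1.
Qed.

Theorem theorem39 (A : arena) (p1 p2 : augmentation A) :
  causal_strategy p1 -> causal_strategy p2 ->
  positions p1 = positions p2 -> isomorphic p1 p2.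
Proof.
move=> cs1 cs2 pos_eq; apply: (isomorphic_of_unfold cs1 cs2) => s1 s2 ms1 ms2 n.
have [rec1 ml1] := cs1; have [rec2 ml2] := cs2.
have mr : minimal (@cle A p1) s1 by apply/(seq_minimal (aug_seq p1)).
pose q := dup mr; pose V1 : view (@ale A q) _ := dup_view mr.
have : positions p1 (iso_class (desq q)).
  exists q; split=> //; exists (@phd A p1 s1); split.
    by split; [exact: (view_display V1)|exact: (view_prec V1)|exact: (view_dprec V1)].
  move=> a b /is_negP na _ ab; have [c ac <-] := view_obs V1 na ab; by exists c.
rewrite pos_eq => -[q' [[phi [mphi obs]] iso_eq]].
(* The class of [D(q')] contains [D(q')] and equals the class of [D(q)]. *)
have : config_iso q q' by have := config_iso_refl q'; rewrite -/(iso_class q' q') -iso_eq.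
move=> [theta [tbij tdisp tprec]].
(* The causal order of [q'] is pulled back to the events of [q], so that [D(q)] carries an expansion
   of each strategy. *)
have V2 := pull_view tbij tdisp tprec (morphism_view mphi obs).
have [_ _ [r [mrq _]]] := cle_tree q.
have fq : full q by exact: dup_full.
rewrite (view_unfold n cs1 fq V1 mrq ms1) (view_unfold n cs2 fq V2 mrq ms2).
congr tmap; apply: (obeh_eq (kappa := @dup_kappa A p1 s1 mr) fq _ _ _ V1 V2 ml1 ml2).
- by [].
- by move=> x; exact: dup_kappa_card.
- by move=> x y; exact: dup_forkE.
- exact: root_neg.
Qed.
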